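(* Let $R$ be a ring and let $(P,Q,\psi)$ be an $R$-system satisfying condition (FS). Let $\mathcal{C}^{inj,grad}_{(P,Q,\psi)}$ be the subcategory of $\mathcal{C}_{(P,Q,\psi)}$ consisting of all surjective, injective and graded covariant representations of $(P,Q,\psi)$. Let $J$ be a two-sided ideal of $R$ such that $J\subseteq\Delta^{-1}(\mathcal{F}_P(Q))$ and $J\cap\ker\Delta=0$. Then the following three statements are equivalent: (1) The Cuntz-Pimsner ring $\mathcal{O}_{(P,Q,\psi)}(J)$ of $(P,Q,\psi)$ relative to $J$ satisfies the Graded Uniqueness Theorem. (2) The Cuntz-Pimsner representation $(\iota_P^J,\iota_Q^J,\iota_R^J,\mathcal{O}_{(P,Q,\psi)}(J))$ of $(P,Q,\psi)$ relative to $J$ is minimal in $\mathcal{C}^{inj,grad}_{(P,Q,\psi)}$ in the sense that if $(S,T,\sigma,B)$ is a surjective, injective and graded representation of $(P,Q,\psi)$ and $\eta:\mathcal{O}_{(P,Q,\psi)}(J)\to B$ is a ring homomorphism such that $\eta\circ\iota_Q^J=T$, $\eta\circ\iota_P^J=S$ and $\eta\circ\iota_R^J=\sigma$, then $\eta$ is an isomorphism. (3) $J$ is maximal.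
   Context: Rings are associative, not necessarily unital. For $R$-bimodules $P,Q$, $P\otimes Q$ is the $R$-balanced tensor product. ''Linear'' means additive. An $R$-system is a triple $(P,Q,\psi)$ where $P,Q$ are $R$-bimodules and $\psi:P\otimes Q\to R$ is an $R$-bimodule homomorphism. A covariant representation of $(P,Q,\psi)$ is a quadruple $(S,T,\sigma,B)$ where $B$ is a ring, $S:P\to B$ and $T:Q\to B$ are linear maps, $\sigma:R\to B$ is a ring homomorphism, and $S(pr)=S(p)\sigma(r)$, $S(rp)=\sigma(r)S(p)$, $T(qr)=T(q)\sigma(r)$, $T(rq)=\sigma(r)T(q)$, $\sigma(\psi(p\otimes q))=S(p)T(q)$ for all $r\in R,p\in P,q\in Q$. It is surjective if $B$ is generated as a ring by $\sigma(R)\cup T(Q)\cup S(P)$, injective if $\sigma$ is injective. A surjective covariant representation is graded if $B$ has a $\mathbb{Z}$-grading $\bigoplus_{n}B^{(n)}$ with $\sigma(R)\subseteq B^{(0)}$, $T(Q)\subseteq B^{(1)}$, $S(P)\subseteq B^{(-1)}$. $\mathcal{C}_{(P,Q,\psi)}$ is the category of surjective covariant representations, a morphism $(S_1,T_1,\sigma_1,B_1)\to(S_2,T_2,\sigma_2,B_2)$ being a ring homomorphism $\phi:B_1\to B_2$ with $\phi\circ T_1=T_2$, $\phi\circ S_1=S_2$, $\phi\circ\sigma_1=\sigma_2$. The Toeplitz representation $(\iota_P,\iota_Q,\iota_R,\mathcal{T}_{(P,Q,\psi)})$ is the (up to isomorphism unique) surjective covariant representation such that for every covariant representation $(S,T,\sigma,B)$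 there is a unique ring homomorphism $\eta:\mathcal{T}_{(P,Q,\psi)}\to B$ with $\eta\circ\iota_R=\sigma$, $\eta\circ\iota_Q=T$, $\eta\circ\iota_P=S$; it exists and is injective. For $p\in P,q\in Q$: $\theta_{q,p}:Q\to Q$, $x\mapsto q\psi(p\otimes x)$, and $\theta_{p,q}:P\to P$, $y\mapsto\psi(y\otimes q)p$. $\mathcal{F}_P(Q)$ is the additive span of all $\theta_{q,p}$, $\mathcal{F}_Q(P)$ the additive span of all $\theta_{p,q}$. Condition (FS): for all finite sets $\{q_1,\dots,q_n\}\subseteq Q$, $\{p_1,\dots,p_m\}\subseteq P$ there exist $\Theta\in\mathcal{F}_P(Q)$ and $\Omega\in\mathcal{F}_Q(P)$ with $\Theta(q_i)=q_i$ and $\Omega(p_j)=p_j$ for all $i,j$. $\Delta:R\to\operatorname{End}(Q_R)$ is the ring homomorphism $\Delta(r)(q)=rq$. Under (FS) there is a unique ring homomorphism $\pi:\mathcal{F}_P(Q)\to\mathcal{T}_{(P,Q,\psi)}$ with $\pi(\theta_{q,p})=\iota_Q(q)\iota_P(p)$. A two-sided ideal $J$ of $R$ is $\psi$-compatible if $J\subseteq\Delta^{-1}(\mathcal{F}_P(Q))$; a $\psi$-compatible $J$ is faithful if $J\cap\ker\Delta=\{0\}$; a faithful $\psi$-compatible two-sided ideal $J$ is maximal if $J=J'$ for any faithful $\psi$-compatible two-sided ideal $J'$ of $R$ with $J\subseteq J'$. For $\psi$-compatible $J$, $\mathcal{T}(J)$ is the two-sided ideal of $\mathcal{T}_{(P,Q,\psi)}$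 generated by $\{\iota_R(x)-\pi(\Delta(x)):x\in J\}$, $\mathcal{O}_{(P,Q,\psi)}(J):=\mathcal{T}_{(P,Q,\psi)}/\mathcal{T}(J)$ with quotient map $\rho_J$, and $\iota_R^J=\rho_J\circ\iota_R$, $\iota_Q^J=\rho_J\circ\iota_Q$, $\iota_P^J=\rho_J\circ\iota_P$. The ring $\mathcal{O}_{(P,Q,\psi)}(J)$ carries the unique $\mathbb{Z}$-grading for which $\iota_R^J(R)$, $\iota_Q^J(Q)$, $\iota_P^J(P)$ lie in degrees $0,1,-1$ respectively. For faithful $\psi$-compatible $J$, $\mathcal{O}_{(P,Q,\psi)}(J)$ satisfies the Graded Uniqueness Theorem if: whenever $B$ is a $\mathbb{Z}$-graded ring and $\eta:\mathcal{O}_{(P,Q,\psi)}(J)\to B$ is a graded ring homomorphism such that $\eta\circ\iota_R^J$ is injective, then $\eta$ is injective. *)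

(* Defs.v *)
From HB Require Import structures.
From mathcomp Require Import all_boot all_order all_algebra.
From mathcomp Require Import boolp classical_sets.

Set Implicit Arguments.
Unset Strict Implicit.
Unset Printing Implicit Defensive.

Import GRing.Theory.
Local Open Scope classical_set_scope.
Local Open Scope ring_scope.

Reserved Notation "x ** y" (at level 40, left associativity).
Reserved Notation "r *> v" (at level 40, left associativity).
Reserved Notation "v <* r" (at level 40, left associativity).

(* Associative rings, with or without an identity. *)
HB.mixin Record Zmodule_isNuRing R of GRing.Zmodule R := {
  numul : R -> R -> R;
  numulA : associative numul;
  numulDl : left_distributive numul +%R;
  numulDr : right_distributive numul +%R
}.
#[short(type="nuRingType")]
HB.structure Definition NuRing := {R of Zmodule_isNuRing R & GRing.Zmodule R}.

Notation "x ** y" := (numul x y) : ring_scope.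

Section NuRingTheory.
Variable A : nuRingType.

Lemma numul0r (x : A) : 0 ** x = 0.
Proof. by apply: (addIr (0 ** x)); rewrite -numulDl !add0r. Qed.

Lemma numulr0 (x : A) : x ** 0 = 0.
Proof. by apply: (addIr (x ** 0)); rewrite -numulDr !add0r. Qed.

Lemma numulNr (x y : A) : (- x) ** y = - (x ** y).
Proof. by apply: (addIr (x ** y)); rewrite -numulDl !addNr numul0r. Qed.

Lemma numulrN (x y : A) : x ** (- y) = - (x ** y).
Proof. by apply: (addIr (x ** y)); rewrite -numulDr !addNr numulr0. Qed.

Lemma numulBl (x y z : A) : (x - y) ** z = x ** z - y ** z.
Proof. by rewrite numulDl numulNr. Qed.

Lemma numulBr (x y z : A) : x ** (y - z) = x ** y - x ** z.
Proof. by rewrite numulDr numulrN. Qed.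

End NuRingTheory.

Definition nuring_morphism (A B : nuRingType) (f : A -> B) : Prop :=
  zmod_morphism f /\ {morph f : x y / x ** y}.

Definition nuring_isomorphism (A B : nuRingType) (f : A -> B) : Prop :=
  nuring_morphism f /\ bijective f.

Definition additive_subgroup (V : zmodType) (H : set V) : Prop :=
  H 0 /\ forall x y, H x -> H y -> H (x - y).

Definition nu_subring (A : nuRingType) (H : set A) : Prop :=
  additive_subgroup H /\ forall x y, H x -> H y -> H (x ** y).

Definition two_sided_ideal (A : nuRingType) (I : set A) : Prop :=
  additive_subgroup I /\ forall a x, I x -> I (a ** x) /\ I (x ** a).

Definition ring_generated_by (A : nuRingType) (X : set A) : Prop :=
  forall H : set A, nu_subring H -> X `<=` H -> H = setT.

Definition ideal_generated (A : nuRingType) (X : set A) : set A :=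
  [set x | forall I : set A, two_sided_ideal I -> X `<=` I -> I x].

Lemma ideal_generated_ideal (A : nuRingType) (X : set A) :
  two_sided_ideal (ideal_generated X).
Proof.
split; first split.
- by move=> I [[]].
- by move=> x y hx hy I hI hX; apply: hI.1.2; [exact: hx | exact: hy].
- by move=> a x hx; split=> I hI hX; case: (hI.2 a x (hx I hI hX)).
Qed.

Section IdealQuotient.
Variables (A : nuRingType) (X : set A).

Definition ideal_generated_pred : {pred A} :=
  fun x => `[< ideal_generated X x >].

Fact ideal_generated_zmod_closed : zmod_closed ideal_generated_pred.
Proof.
case: (ideal_generated_ideal X) => -[h0 hB] _; split; first exact/asboolP.
by move=> x y /asboolP hx /asboolP hy; apply/asboolP; apply: hB.
Qed.

HB.instance Definition _ :=
  GRing.isZmodClosed.Build A ideal_generated_pred ideal_generated_zmod_closed.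

Definition ideal_quot : Type := Quotient.quot ideal_generated_pred.

HB.instance Definition _ := GRing.Zmodule.on ideal_quot.

Definition quot_proj : A -> ideal_quot := \pi_(Quotient.quot ideal_generated_pred)%qT.

Lemma quot_proj_zmod_morphism : zmod_morphism quot_proj.
Proof. exact: pi_is_zmod_morphism. Qed.

Lemma quot_proj_eq x y :
  quot_proj x = quot_proj y <-> ideal_generated X (x - y).
Proof.
split=> [/eqP | h].
  by rewrite /quot_proj -Quotient.idealrBE => /asboolP.
by apply/eqP; rewrite /quot_proj -Quotient.idealrBE; apply/asboolP.
Qed.

Lemma quot_proj_surj (u : ideal_quot) : exists x, quot_proj x = u.
Proof. by exists (repr u); rewrite /quot_proj reprK. Qed.

Definition quot_mul (u v : ideal_quot) : ideal_quot :=
  quot_proj (repr u ** repr v).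

Lemma quot_mulE x y : quot_mul (quot_proj x) (quot_proj y) = quot_proj (x ** y).
Proof.
apply/quot_proj_eq.
set x' := repr _; set y' := repr _.
have hx : ideal_generated X (x' - x).
  by apply/quot_proj_eq; rewrite /quot_proj reprK.
have hy : ideal_generated X (y' - y).
  by apply/quot_proj_eq; rewrite /quot_proj reprK.
have [[h0 hB] hM] := ideal_generated_ideal X.
have -> : x' ** y' - x ** y = (x' - x) ** y' - x ** (y - y').
  by rewrite numulBl numulBr opprB addrA addrNK.
apply: (hB); first by case: (hM y' _ hx).
have hy' : ideal_generated X (y - y').
  by have := hB _ _ h0 hy; rewrite sub0r opprB.
by case: (hM x _ hy').
Qed.

Fact quot_mulA : associative quot_mul.
Proof.
move=> u v w; have [x <-] := quot_proj_surj u; have [y <-] := quot_proj_surj v.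
by have [z <-] := quot_proj_surj w; rewrite !quot_mulE numulA.
Qed.

Let quot_projD : {morph quot_proj : x y / x + y}.
Proof.
move=> x y; have hN z : quot_proj (- z) = - quot_proj z.
  by rewrite -[- z]sub0r quot_proj_zmod_morphism -[0](subrr z)
             quot_proj_zmod_morphism subrr sub0r.
by rewrite -{1}[y]opprK quot_proj_zmod_morphism hN opprK.
Qed.

Fact quot_mulDl : left_distributive quot_mul +%R.
Proof.
move=> u v w; have [x <-] := quot_proj_surj u; have [y <-] := quot_proj_surj v.
have [z <-] := quot_proj_surj w.
by rewrite -quot_projD !quot_mulE numulDl quot_projD.
Qed.

Fact quot_mulDr : right_distributive quot_mul +%R.
Proof.
move=> u v w; have [x <-] := quot_proj_surj u; have [y <-] := quot_proj_surj v.
have [z <-] := quot_proj_surj w.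
by rewrite -quot_projD !quot_mulE numulDr quot_projD.
Qed.

HB.instance Definition _ :=
  Zmodule_isNuRing.Build ideal_quot quot_mulA quot_mulDl quot_mulDr.

Lemma quot_proj_morphism : nuring_morphism quot_proj.
Proof.
by split=> [|x y]; [exact: quot_proj_zmod_morphism | rewrite -quot_mulE].
Qed.

End IdealQuotient.

(* G is a Z-grading of A: A is the internal direct sum of the subgroups G n,
   and G m G n is contained in G (m + n). *)
Record Zgrading (A : nuRingType) (G : int -> set A) : Prop := {
  Zgrading_subgroup : forall n, additive_subgroup (G n);
  Zgrading_mul : forall m n x y, G m x -> G n y -> G (m + n) (x ** y);
  Zgrading_span : forall x, exists (s : seq int) (c : int -> A),
    (forall n, G n (c n)) /\ x = \sum_(n <- s) c n;
  Zgrading_indep : forall (s : seq int) (c : int -> A), uniq s ->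
    (forall n, G n (c n)) -> \sum_(n <- s) c n = 0 ->
    forall n, n \in s -> c n = 0
}.

Definition graded_morphism (A B : nuRingType) (GA : int -> set A)
    (GB : int -> set B) (f : A -> B) : Prop :=
  nuring_morphism f /\ forall n x, GA n x -> GB n (f x).

HB.mixin Record Zmodule_isBimodule (R : nuRingType) V of GRing.Zmodule V := {
  lact : R -> V -> V;
  ract : V -> R -> V;
  lactDr : forall r, {morph lact r : v w / v + w};
  lactDl : forall r s v, lact (r + s) v = lact r v + lact s v;
  lactA : forall r s v, lact (r ** s) v = lact r (lact s v);
  ractDl : forall r, {morph ract^~ r : v w / v + w};
  ractDr : forall r s v, ract v (r + s) = ract v r + ract v s;
  ractA : forall r s v, ract v (r ** s) = ract (ract v r) s;
  lractA : forall r s v, ract (lact r v) s = lact r (ract v s)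
}.
#[short(type="bimodType")]
HB.structure Definition Bimodule (R : nuRingType) :=
  {V of Zmodule_isBimodule R V & GRing.Zmodule V}.

Notation "r *> v" := (lact r v) : ring_scope.
Notation "v <* r" := (ract v r) : ring_scope.

(* A bimodule homomorphism on the balanced tensor product of P and Q is given
   by its values psi p q on the elementary tensors: a biadditive R-balanced map
   compatible with the outer actions. *)
Record Rsystem (R : nuRingType) := MkRsystem {
  sysP : bimodType R;
  sysQ : bimodType R;
  psi : sysP -> sysQ -> R;
  psi_additivel : forall q, zmod_morphism (psi^~ q);
  psi_additiver : forall p, zmod_morphism (psi p);
  psi_balanced : forall p r q, psi (p <* r) q = psi p (r *> q);
  psi_lact : forall r p q, psi (r *> p) q = r ** psi p q;
  psi_ract : forall p q r, psi p (q <* r) = psi p q ** r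
}.

Section System.
Variables (R : nuRingType) (sys : Rsystem R).
Local Notation P := (sysP sys).
Local Notation Q := (sysQ sys).
Local Notation psi := (@psi R sys).

Record covrep := MkCovrep {
  covB :> nuRingType;
  covS : P -> covB;
  covT : Q -> covB;
  covsigma : R -> covB;
  covS_additive : zmod_morphism covS;
  covT_additive : zmod_morphism covT;
  covsigma_morphism : nuring_morphism covsigma;
  covS_ract : forall p r, covS (p <* r) = covS p ** covsigma r;
  covS_lact : forall r p, covS (r *> p) = covsigma r ** covS p;
  covT_ract : forall q r, covT (q <* r) = covT q ** covsigma r;
  covT_lact : forall r q, covT (r *> q) = covsigma r ** covT q;
  cov_psi : forall p q, covsigma (psi p q) = covS p ** covT q
}.

Definition surjective_covrep (X : covrep) : Prop :=
  ring_generated_by (range (@covsigma X) `|` range (@covT X) `|` range (@covS X)).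

Definition injective_covrep (X : covrep) : Prop := injective (@covsigma X).

Definition covrep_grading (X : covrep) (G : int -> set X) : Prop :=
  [/\ Zgrading G,
      range (@covsigma X) `<=` G 0,
      range (@covT X) `<=` G 1
    & range (@covS X) `<=` G (-1)].

Definition graded_covrep (X : covrep) : Prop :=
  exists G : int -> set X, covrep_grading G.

Definition covrep_morphism (X Y : covrep) (f : X -> Y) : Prop :=
  [/\ nuring_morphism f,
      f \o @covT X = @covT Y,
      f \o @covS X = @covS Y
    & f \o @covsigma X = @covsigma Y].

Definition is_toeplitz (X : covrep) : Prop :=
  surjective_covrep X /\
  forall Y : covrep, exists! eta : X -> Y, covrep_morphism eta.

Definition thetaQ (q : Q) (p : P) : Q -> Q := fun x => q <* psi p x.
Definition thetaP (p : P) (q : Q) : P -> P := fun y => psi y q *> p.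

(* Finite sums suffice for the additive spans: the opposite of thetaQ q p is
   thetaQ (- q) p, and likewise for thetaP. *)
Definition FPQ : set (Q -> Q) :=
  [set f | exists s : seq (Q * P),
     f = fun x => \sum_(qp <- s) thetaQ qp.1 qp.2 x].
Definition FQP : set (P -> P) :=
  [set f | exists s : seq (P * Q),
     f = fun y => \sum_(pq <- s) thetaP pq.1 pq.2 y].

Definition condition_FS : Prop :=
  forall (qs : seq Q) (ps : seq P), exists (Theta : Q -> Q) (Omega : P -> P),
    [/\ FPQ Theta, FQP Omega,
        forall q, q \in qs -> Theta q = q
      & forall p, p \in ps -> Omega p = p].

Definition Delta (r : R) : Q -> Q := fun q => r *> q.

Definition ker_Delta : set R := [set r | Delta r = fun=> 0].

Definition psi_compatible (J : set R) : Prop := J `<=` Delta @^-1` FPQ.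

Definition faithful_ideal (J : set R) : Prop := J `&` ker_Delta = [set 0].

Definition maximal_faithful (J : set R) : Prop :=
  forall J' : set R, two_sided_ideal J' -> psi_compatible J' ->
    faithful_ideal J' -> J `<=` J' -> J = J'.

(* pi restricts to a ring homomorphism on FPQ (whose product is composition)
   with pi (thetaQ q p) = covT q ** covS p; outside FPQ it is unconstrained. *)
Definition is_theta_lift (X : covrep) (pi : (Q -> Q) -> X) : Prop :=
  [/\ forall f g, FPQ f -> FPQ g -> pi (f \+ g) = pi f + pi g,
      forall f g, FPQ f -> FPQ g -> pi (f \o g) = pi f ** pi g
    & forall q p, pi (thetaQ q p) = covT X q ** covS X p].

Section CuntzPimsner.
Variables (T : covrep) (pi : (Q -> Q) -> T) (J : set R).

Definition CP_relations : set T := [set covsigma T x - pi (Delta x) | x in J].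

Definition CP_ring : nuRingType := ideal_quot CP_relations.

Local Notation rho := (@quot_proj T CP_relations).

Fact CP_zmod_morphism (V : zmodType) (f : V -> T) :
  zmod_morphism f -> zmod_morphism (rho \o f).
Proof. by move=> hf x y /=; rewrite hf quot_proj_zmod_morphism. Qed.

Fact CP_sigma_morphism : nuring_morphism (rho \o covsigma T : R -> CP_ring).
Proof.
have [hB hM] := covsigma_morphism T; split; first exact: CP_zmod_morphism.
by move=> x y /=; rewrite hM (quot_proj_morphism _).2.
Qed.

(* O(J) with the maps iota_P^J, iota_Q^J and iota_R^J *)
Definition CP : covrep.
Proof.
refine (@MkCovrep CP_ring (rho \o covS T) (rho \o covT T) (rho \o covsigma T)
  (CP_zmod_morphism (@covS_additive T)) (CP_zmod_morphism (@covT_additive T))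
  CP_sigma_morphism _ _ _ _ _) => [p r|r p|q r|r q|p q] /=;
by rewrite -(quot_proj_morphism _).2 -?covS_ract -?covS_lact
           -?covT_ract -?covT_lact -?cov_psi.
Defined.

End CuntzPimsner.

(* The quantification over GX is over the grading of X with the images of R, Q
   and P in degrees 0, 1 and -1; for O(J) it exists and is unique. *)
Definition graded_uniqueness (X : covrep) : Prop :=
  forall GX : int -> set X, covrep_grading GX ->
  forall (B : nuRingType) (GB : int -> set B), Zgrading GB ->
  forall eta : X -> B, graded_morphism GX GB eta ->
    injective (eta \o @covsigma X) -> injective eta.

Definition minimal_covrep (X : covrep) : Prop :=
  forall Y : covrep,
    surjective_covrep Y -> injective_covrep Y -> graded_covrep Y ->
  forall eta : X -> Y, covrep_morphism eta -> nuring_isomorphism eta.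

End System.

(* Existence of the Toeplitz representation: the ring presented by the
   generators R, Q, P and the relations of a covariant representation. *)
Section ToeplitzExistence.
Variables (R : nuRingType) (sys : Rsystem R).
Local Notation P := (sysP sys).
Local Notation Q := (sysQ sys).

Inductive tterm : Type :=
  | tR of R | tQ of Q | tP of P
  | tzero | topp of tterm | tadd of tterm & tterm | tmul of tterm & tterm.

Inductive teq : tterm -> tterm -> Prop :=
  | teq_refl a : teq a a
  | teq_sym a b : teq a b -> teq b a
  | teq_trans a b c : teq a b -> teq b c -> teq a c
  | teq_opp a b : teq a b -> teq (topp a) (topp b)
  | teq_add a a' b b' : teq a a' -> teq b b' -> teq (tadd a b) (tadd a' b')
  | teq_mul a a' b b' : teq a a' -> teq b b' -> teq (tmul a b) (tmul a' b')
  | teq_addA a b c : teq (tadd a (tadd b c)) (tadd (tadd a b) c)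
  | teq_addC a b : teq (tadd a b) (tadd b a)
  | teq_add0 a : teq (tadd tzero a) a
  | teq_addN a : teq (tadd (topp a) a) tzero
  | teq_mulA a b c : teq (tmul a (tmul b c)) (tmul (tmul a b) c)
  | teq_mulDl a b c : teq (tmul (tadd a b) c) (tadd (tmul a c) (tmul b c))
  | teq_mulDr a b c : teq (tmul a (tadd b c)) (tadd (tmul a b) (tmul a c))
  | teq_RB x y : teq (tR (x - y)) (tadd (tR x) (topp (tR y)))
  | teq_QB x y : teq (tQ (x - y)) (tadd (tQ x) (topp (tQ y)))
  | teq_PB x y : teq (tP (x - y)) (tadd (tP x) (topp (tP y)))
  | teq_RM x y : teq (tR (x ** y)) (tmul (tR x) (tR y))
  | teq_Pr p r : teq (tP (p <* r)) (tmul (tP p) (tR r))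
  | teq_Pl r p : teq (tP (r *> p)) (tmul (tR r) (tP p))
  | teq_Qr q r : teq (tQ (q <* r)) (tmul (tQ q) (tR r))
  | teq_Ql r q : teq (tQ (r *> q)) (tmul (tR r) (tQ q))
  | teq_psi p q : teq (tR (psi p q)) (tmul (tP p) (tQ q)).

Local Notation term := {classic tterm}.

Definition teqb (a b : term) : bool := `[< teq a b >].

Fact teqb_equiv : equiv_class_of teqb.
Proof.
split=> [a|a b|b a c]; first by apply/asboolP; apply: teq_refl.
  by apply/asboolP/asboolP; apply: teq_sym.
by move=> /asboolP h /asboolP k; apply/asboolP; apply: teq_trans h k.
Qed.

Canonical teqb_equivRel := EquivRelPack teqb_equiv.
Canonical teqb_encModRel := defaultEncModRel teqb.

Definition toep : Type := {eq_quot teqb}%qT.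
HB.instance Definition _ := Choice.on toep.
HB.instance Definition _ := EqQuotient.on toep.

Definition tcl (a : tterm) : toep := \pi_({eq_quot teqb})%qT (a : term).

Lemma tclP a b : tcl a = tcl b <-> teq a b.
Proof.
split=> [/eqP|h]; first by rewrite /tcl eqmodE => /asboolP.
by apply/eqP; rewrite /tcl eqmodE; apply/asboolP.
Qed.

Definition trep (u : toep) : tterm := repr u.

Lemma trepK u : tcl (trep u) = u. Proof. exact: reprK. Qed.

Lemma tcl_trep a : teq (trep (tcl a)) a. Proof. by apply/tclP; rewrite trepK. Qed.

Definition toep_opp u := tcl (topp (trep u)).
Definition toep_add u v := tcl (tadd (trep u) (trep v)).
Definition toep_mul u v := tcl (tmul (trep u) (trep v)).

Lemma toep_oppE a : toep_opp (tcl a) = tcl (topp a).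
Proof. by apply/tclP; apply: teq_opp; apply: tcl_trep. Qed.
Lemma toep_addE a b : toep_add (tcl a) (tcl b) = tcl (tadd a b).
Proof. by apply/tclP; apply: teq_add; apply: tcl_trep. Qed.
Lemma toep_mulE a b : toep_mul (tcl a) (tcl b) = tcl (tmul a b).
Proof. by apply/tclP; apply: teq_mul; apply: tcl_trep. Qed.

Let toepE := (toep_oppE, toep_addE, toep_mulE).

Fact toep_addA : associative toep_add.
Proof.
move=> u v w; rewrite -(trepK u) -(trepK v) -(trepK w) !toepE.
exact/tclP/teq_addA.
Qed.
Fact toep_addC : commutative toep_add.
Proof. by move=> u v; rewrite -(trepK u) -(trepK v) !toepE; exact/tclP/teq_addC. Qed.
Fact toep_add0 : left_id (tcl tzero) toep_add.
Proof. by move=> u; rewrite -(trepK u) !toepE; exact/tclP/teq_add0. Qed.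
Fact toep_addN : left_inverse (tcl tzero) toep_opp toep_add.
Proof. by move=> u; rewrite -(trepK u) !toepE; exact/tclP/teq_addN. Qed.

HB.instance Definition _ :=
  GRing.isZmodule.Build toep toep_addA toep_addC toep_add0 toep_addN.

Fact toep_mulA : associative toep_mul.
Proof.
move=> u v w; rewrite -(trepK u) -(trepK v) -(trepK w) !toepE.
exact/tclP/teq_mulA.
Qed.
Fact toep_mulDl : left_distributive toep_mul +%R.
Proof.
move=> u v w; rewrite -(trepK u) -(trepK v) -(trepK w).
rewrite /GRing.add /= !toepE; exact/tclP/teq_mulDl.
Qed.
Fact toep_mulDr : right_distributive toep_mul +%R.
Proof.
move=> u v w; rewrite -(trepK u) -(trepK v) -(trepK w).
rewrite /GRing.add /= !toepE; exact/tclP/teq_mulDr.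
Qed.

HB.instance Definition _ :=
  Zmodule_isNuRing.Build toep toep_mulA toep_mulDl toep_mulDr.

Lemma tclN a : tcl (topp a) = - tcl a. Proof. by rewrite -toep_oppE. Qed.
Lemma tclD a b : tcl (tadd a b) = tcl a + tcl b. Proof. by rewrite -toep_addE. Qed.
Lemma tclM a b : tcl (tmul a b) = tcl a ** tcl b. Proof. by rewrite -toep_mulE. Qed.

Definition toeplitz : covrep sys.
Proof.
refine (@MkCovrep _ sys toep (tcl \o tP) (tcl \o tQ) (tcl \o tR)
          _ _ _ _ _ _ _ _).
- by move=> x y /=; rewrite -tclN -tclD; exact/tclP/teq_PB.
- by move=> x y /=; rewrite -tclN -tclD; exact/tclP/teq_QB.
- split=> x y /=; first by rewrite -tclN -tclD; exact/tclP/teq_RB.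
  by rewrite -tclM; exact/tclP/teq_RM.
- by move=> p r /=; rewrite -tclM; exact/tclP/teq_Pr.
- by move=> r p /=; rewrite -tclM; exact/tclP/teq_Pl.
- by move=> q r /=; rewrite -tclM; exact/tclP/teq_Qr.
- by move=> r q /=; rewrite -tclM; exact/tclP/teq_Ql.
- by move=> p q /=; rewrite -tclM; exact/tclP/teq_psi.
Defined.

Fixpoint teval (Y : covrep sys) (a : tterm) : Y :=
  match a with
  | tR r => covsigma Y r | tQ q => covT Y q | tP p => covS Y p
  | tzero => 0 | topp a => - teval Y a
  | tadd a b => teval Y a + teval Y b
  | tmul a b => teval Y a ** teval Y b
  end.

Lemma teval_teq Y a b : teq a b -> teval Y a = teval Y b.
Proof.
elim=> //=.
- by move=> x y z _ -> _ ->.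
- by move=> x y _ ->.
- by move=> x x' y y' _ -> _ ->.
- by move=> x x' y y' _ -> _ ->.
- by move=> x y z; rewrite addrA.
- by move=> x y; rewrite addrC.
- by move=> x; rewrite add0r.
- by move=> x; rewrite addNr.
- by move=> x y z; rewrite numulA.
- by move=> x y z; rewrite numulDl.
- by move=> x y z; rewrite numulDr.
- by move=> x y; rewrite (covsigma_morphism Y).1.
- by move=> x y; rewrite (@covT_additive _ _ Y).
- by move=> x y; rewrite (@covS_additive _ _ Y).
- by move=> x y; rewrite (covsigma_morphism Y).2.
- exact: covS_ract.
- exact: covS_lact.
- exact: covT_ract.
- exact: covT_lact.
- exact: cov_psi.
Qed.

Lemma toeplitz_generated (H : set toeplitz) : nu_subring H ->
  range (@covsigma _ _ toeplitz) `|` range (@covT _ _ toeplitz)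
    `|` range (@covS _ _ toeplitz) `<=` H -> forall u, H u.
Proof.
move=> [[h0 hB] hM] hg u; rewrite -(trepK u).
have hN x : H x -> H (- x) by move=> hx; rewrite -[- x]sub0r; apply: hB.
have hD x y : H x -> H y -> H (x + y).
  by move=> hx hy; rewrite -[y]opprK; apply: hB => //; apply: hN.
elim: (trep u) => [r|q|p||a IHa|a IHa b IHb|a IHa b IHb].
- by apply: hg; left; left; exists r.
- by apply: hg; left; right; exists q.
- by apply: hg; right; exists p.
- exact: h0.
- by rewrite tclN; apply: hN.
- by rewrite tclD; apply: hD.
- by rewrite tclM; apply: hM.
Qed.

Lemma toeplitzP : is_toeplitz toeplitz.
Proof.
split=> [H hH hg|Y].
  by apply/seteqP; split=> // u _; apply: toeplitz_generated hH hg u.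
pose eta (u : toeplitz) : Y := teval Y (trep u).
have etaE a : eta (tcl a) = teval Y a by apply: teval_teq; apply: tcl_trep.
have etaB : zmod_morphism eta.
  by move=> u v; rewrite -(trepK u) -(trepK v) -tclN -tclD !etaE.
have etaM : {morph eta : x y / x ** y}.
  by move=> u v; rewrite -(trepK u) -(trepK v) -tclM !etaE.
exists eta; split.
  by split=> //; apply/funext => x; apply: etaE.
move=> f [[fB fM] fT fS fsig]; apply/funext => u; rewrite -(trepK u) etaE.
have f0 : f 0 = 0 by rewrite -(subrr 0) fB subrr.
have fN x : f (- x) = - f x by rewrite -[- x]sub0r fB f0 sub0r.
elim: (trep u) => [r|q|p||a IHa|a IHa b IHb|a IHa b IHb] /=.
- by rewrite -fsig.
- by rewrite -fT.
- by rewrite -fS.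
- by rewrite -f0.
- by rewrite tclN fN IHa.
- by rewrite tclD -{1}[tcl b]opprK fB fN opprK IHa IHb.
- by rewrite tclM fM IHa IHb.
Qed.

End ToeplitzExistence.

Section ThetaLiftExistence.
Variables (R : nuRingType) (sys : Rsystem R) (X : covrep sys).
Local Notation P := (sysP sys).
Local Notation Q := (sysQ sys).
Local Notation thsum := (fun s : seq (Q * P) => fun x : Q =>
  \sum_(qp <- s) thetaQ qp.1 qp.2 x).
Local Notation lift := (fun s : seq (Q * P) =>
  \sum_(qp <- s) covT X qp.1 ** covS X qp.2).

Let add0 (U V : zmodType) (f : U -> V) : zmod_morphism f -> f 0 = 0.
Proof. by move=> fB; rewrite -(subrr 0) fB subrr. Qed.

Let addD (U V : zmodType) (f : U -> V) : zmod_morphism f ->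
  {morph f : x y / x + y}.
Proof.
move=> fB x y; have fN z : f (- z) = - f z by rewrite -[- z]sub0r fB add0 // sub0r.
by rewrite -{1}[y]opprK fB fN opprK.
Qed.

Let addS (U V : zmodType) (f : U -> V) : zmod_morphism f ->
  forall I (s : seq I) F, f (\sum_(i <- s) F i) = \sum_(i <- s) f (F i).
Proof. by move=> fB I s F; apply: big_morph; [exact: addD | exact: add0]. Qed.

Let mulSl I (s : seq I) F (y : X) :
  (\sum_(i <- s) F i) ** y = \sum_(i <- s) F i ** y.
Proof. by apply: (big_morph (numul^~ y)) => [u v|]; rewrite ?numulDl ?numul0r. Qed.

Let mulSr I (s : seq I) F (y : X) :
  y ** (\sum_(i <- s) F i) = \sum_(i <- s) y ** F i.
Proof. by apply: (big_morph (numul y)) => [u v|]; rewrite ?numulDr ?numulr0. Qed.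

Let lift_wd : condition_FS sys -> forall s t, thsum s = thsum t -> lift s = lift t.
Proof.
move=> hFS s t hst.
have [_ [Om [_ [w hw] _ hOm]]] := hFS [::] (map snd (s ++ t)).
have key u : {subset u <= s ++ t} ->
    lift u = \sum_(pq <- w) covT X (thsum u pq.2) ** covS X pq.1.
  move=> hu; under [RHS]eq_bigr => pq _
    do rewrite (addS (@covT_additive _ _ X)) mulSl.
  rewrite exchange_big /= !big_seq; apply: eq_bigr => qp /hu hqp.
  rewrite -{1}(hOm qp.2 (map_f snd hqp)) hw (addS (@covS_additive _ _ X)) mulSr; apply: eq_bigr => pq _.
  by rewrite /thetaP /thetaQ covS_lact covT_ract numulA.
rewrite (key s) => [|x hx]; last by rewrite mem_cat hx.
rewrite (key t) => [|x hx]; last by rewrite mem_cat hx orbT.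
by apply: eq_bigr => pq _; rewrite (congr1 (@^~ pq.2) hst).
Qed.

Lemma theta_lift_exists : condition_FS sys ->
  exists pi : (Q -> Q) -> X, is_theta_lift pi.
Proof.
move=> hFS.
have [pi hpi] : exists pi : (Q -> Q) -> X, forall s, pi (thsum s) = lift s.
  have /choice [pi hpi] : forall f : Q -> Q,
      exists y : X, forall s, f = thsum s -> y = lift s.
    move=> f; have [[s ->]|nf] := pselect (exists s, f = thsum s).
      by exists (lift s) => t; apply: lift_wd.
    by exists 0 => s hs; case: nf; exists s.
  by exists pi => s; apply: hpi.
have th1 q p : thetaQ q p = thsum [:: (q, p)].
  by apply/funext => x; rewrite big_seq1.
exists pi; split.
- move=> _ _ [s ->] [t ->].
  have -> : thsum s \+ thsum t = thsum (s ++ t).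
    by apply/funext => x /=; rewrite big_cat.
  by rewrite !hpi big_cat.
- move=> _ _ [s ->] [t ->].
  pose st := [seq (a.1 <* psi a.2 b.1, b.2) | a <- s, b <- t].
  have -> : thsum s \o thsum t = thsum st.
    apply/funext => x /=; rewrite big_allpairs_dep /=.
    apply: eq_bigr => a _; rewrite /thetaQ (addS (psi_additiver a.2)).
    have rB : zmod_morphism (ract a.1 : R -> Q).
      move=> r r'; apply: (addIr (a.1 <* r')).
      by rewrite -ractDr !addrNK.
    rewrite (addS rB); apply: eq_bigr => b _.
    by rewrite psi_ract ractA.
  rewrite !hpi big_allpairs_dep /= mulSl; apply: eq_bigr => a _.
  rewrite mulSr; apply: eq_bigr => b _.
  by rewrite covT_ract cov_psi !numulA.
- by move=> q p; rewrite th1 hpi big_seq1.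
Qed.

End ThetaLiftExistence.

(* Main.v *)
(* (3) => (1): words of a homogeneous element can be brought to the form
   Q^a P^b. By (FS), if a <> b then x = e x or x = x e for a sum e of products
   q p, so x = 0 as soon as all p x (or all x q) vanish, and the total length
   a + b decreases. If a = b >= 1 and all p x q vanish, then x = r - e for some
   r in R and some sum e of products q p; when moreover eta x = 0, r lies in the
   faithful ideal of those r with Delta r in F_P(Q) and eta r = eta (pi (Delta r)),
   which contains J and hence equals J, so x = 0.

   (2) => (3): for J <= J' minimality makes O(J) -> O(J') bijective, provided
   R -> O(J') is injective; and r - pi (Delta r) in T(J) must force r in J. Both
   are read off a Fock representation that avoids tensor powers: vectors are
   multilinear functions of finite sequences in P with values in the unitization
   of R, p acts by evaluation and q by (q v)(p) = psi(p, q) v. The vacuum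
   component of any element of T(J) applied to a vector lies in J.

   (1) => (2): the grading of O(J), without which (1) is void, comes from letting
   the generators act on Z-indexed families in the unitization of O(J) with a shift
   by their degree. *)

Require Import Defs.
From HB Require Import structures.
From mathcomp Require Import all_boot all_order all_algebra.
From mathcomp Require Import boolp classical_sets functions.

Set Implicit Arguments.
Unset Strict Implicit.
Unset Printing Implicit Defensive.

Import GRing.Theory.
Local Open Scope classical_set_scope.
Local Open Scope ring_scope.

(** * Additive maps, finite sums and additive subgroups *)

Section ZmodMorphism.
Variables (U V : zmodType) (f : U -> V).
Hypothesis fB : zmod_morphism f.

Let F : {additive U -> V} := HB.pack f (GRing.isZmodMorphism.Build U V f fB).

Lemma zmod_morph0 : f 0 = 0. Proof. exact: (raddf0 F). Qed.
Lemma zmod_morphD x y : f (x + y) = f x + f y. Proof. exact: (raddfD F). Qed.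
Lemma zmod_morphN x : f (- x) = - f x. Proof. exact: (raddfN F). Qed.
Lemma zmod_morphMz n x : f (x *~ n) = f x *~ n. Proof. exact: (raddfMz F). Qed.
Lemma zmod_morph_sum I (s : seq I) E :
  f (\sum_(i <- s) E i) = \sum_(i <- s) f (E i).
Proof. exact: (raddf_sum F). Qed.

Lemma zmod_morph_inj : (forall x, f x = 0 -> x = 0) -> injective f.
Proof. by move=> f0 x y e; apply/subr0_eq/f0; rewrite fB e subrr. Qed.

End ZmodMorphism.

Lemma numul_suml (A : nuRingType) I (s : seq I) E (y : A) :
  (\sum_(i <- s) E i) ** y = \sum_(i <- s) E i ** y.
Proof. by apply: (zmod_morph_sum (f := numul^~ y)) => a b; exact: numulBl. Qed.

Lemma numul_sumr (A : nuRingType) I (s : seq I) E (y : A) :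
  y ** (\sum_(i <- s) E i) = \sum_(i <- s) y ** E i.
Proof. by apply: (zmod_morph_sum (f := numul y)) => a b; exact: numulBr. Qed.

Lemma additive_subgroupD (V : zmodType) (H : set V) :
  additive_subgroup H -> forall x y, H x -> H y -> H (x + y).
Proof.
move=> [H0 HB] x y hx hy; rewrite -[y]opprK; apply: (HB) => //.
by rewrite -sub0r; apply: HB.
Qed.

Lemma additive_subgroup_sum (V : zmodType) (H : set V) :
  additive_subgroup H -> forall I (s : seq I) E,
  (forall i, H (E i)) -> H (\sum_(i <- s) E i).
Proof.
move=> hH I s E hE; elim/big_ind: _ => //; first by case: hH.
exact: additive_subgroupD.
Qed.

(** * The endomorphism ring of an abelian group, the target of the concrete representations *)

Section Endomorphisms.
Variable V : zmodType.

Definition zmod_endo_pred : {pred V -> V} := fun f => `[< zmod_morphism f >].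

Record zmod_endo : Type :=
  ZmodEndo { zmod_endo_fun : V -> V; _ : zmod_endo_fun \in zmod_endo_pred }.

HB.instance Definition _ := [isSub of zmod_endo for zmod_endo_fun].
HB.instance Definition _ := [Choice of zmod_endo by <:].

Fact zmod_endo_zmod_closed : zmod_closed zmod_endo_pred.
Proof.
split; first by apply/asboolP => x y; rewrite subrr.
move=> f g /asboolP hf /asboolP hg; apply/asboolP => x y.
by rewrite !fctE hf hg !opprD opprK addrACA.
Qed.

HB.instance Definition _ :=
  GRing.isZmodClosed.Build (V -> V) zmod_endo_pred zmod_endo_zmod_closed.
HB.instance Definition _ := [SubChoice_isSubZmodule of zmod_endo by <:].

Lemma zmod_endoB (f : zmod_endo) : zmod_morphism (val f).
Proof. exact/asboolP/(valP f). Qed.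

Definition mk_endo (f : V -> V) (fB : zmod_morphism f) : zmod_endo :=
  ZmodEndo (introT (asboolP _) fB : f \in zmod_endo_pred).

Fact endo_comp_subproof (f g : zmod_endo) : zmod_morphism (val f \o val g).
Proof. by move=> x y /=; rewrite !zmod_endoB. Qed.

Definition endo_comp (f g : zmod_endo) : zmod_endo :=
  mk_endo (endo_comp_subproof f g).

Lemma endo_evalB v : zmod_morphism (fun f : zmod_endo => val f v).
Proof. by move=> f g. Qed.

Fact endo_compA : associative endo_comp.
Proof. by move=> f g h; apply: val_inj. Qed.
Fact endo_compDl : left_distributive endo_comp +%R.
Proof. by move=> f g h; apply: val_inj. Qed.
Fact endo_compDr : right_distributive endo_comp +%R.
Proof.
move=> f g h; apply: val_inj; apply/funext => v /=.
exact: (zmod_morphD (@zmod_endoB f)).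
Qed.

HB.instance Definition _ :=
  Zmodule_isNuRing.Build zmod_endo endo_compA endo_compDl endo_compDr.

End Endomorphisms.

(** * The action of a ring on its unitization *)

Section Unitization.
Variable A : nuRingType.

(* The left action of A on its unitization A x Z. *)
Definition uact (a : A) (v : A * int) : A * int := (a ** v.1 + a *~ v.2, 0).

Lemma uactB a : zmod_morphism (uact a).
Proof.
move=> v w; congr (_, _) => /=.
by rewrite numulBr mulrzBr opprD addrACA.
Qed.

Lemma uactBl v : zmod_morphism (uact^~ v).
Proof.
move=> a b; congr (_, _) => /=.
by rewrite numulBl mulrzBl opprD addrACA.
Qed.

Lemma uactM a b v : uact (a ** b) v = uact a (uact b v).
Proof.
congr (_, _) => /=; rewrite mulr0z addr0 numulDr numulA.
by rewrite (zmod_morphMz (f := numul a)) // => x y; exact: numulBr.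
Qed.

(** When [A] has no unit, left multiplication on [A] may lose [a]; its value at the adjoined unit
    recovers it. This is how the shift and Fock representations detect elements. *)
Lemma uact1 a : uact a (0, 1) = (a, 0).
Proof. by rewrite /uact /= numulr0 add0r. Qed.

End Unitization.

(** * Morphisms of covariant representations on generators *)

Section CovrepMorphism.
Variables (R : nuRingType) (sys : Rsystem R) (X Y : covrep sys) (f : X -> Y).
Hypothesis hf : covrep_morphism f.

Lemma covrep_morphB : zmod_morphism f. Proof. by case: hf => -[]. Qed.
Lemma covrep_morphM x y : f (x ** y) = f x ** f y. Proof. by case: hf => -[]. Qed.
Lemma covrep_morphT q : f (covT X q) = covT Y q.
Proof. by case: hf => _ <-. Qed.
Lemma covrep_morphS p : f (covS X p) = covS Y p.
Proof. by case: hf => _ _ <-. Qed.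
Lemma covrep_morph_sigma r : f (covsigma X r) = covsigma Y r.
Proof. by case: hf => _ _ _ <-. Qed.

End CovrepMorphism.

(** * Homogeneous elements and decomposition by degree *)

Section Homogeneous.
Variables (R : nuRingType) (sys : Rsystem R) (X : covrep sys).
Local Notation P := (sysP sys).
Local Notation Q := (sysQ sys).
Local Notation sigma := (covsigma X).
Local Notation T := (covT X).
Local Notation S := (covS X).

Lemma sigmaB : zmod_morphism sigma. Proof. by case: (covsigma_morphism X). Qed.
Lemma sigmaM r s : sigma (r ** s) = sigma r ** sigma s.
Proof. by case: (covsigma_morphism X). Qed.
Lemma covTB : zmod_morphism T. Proof. exact: covT_additive. Qed.
Lemma covSB : zmod_morphism S. Proof. exact: covS_additive. Qed.

(* Additive combinations of words of degree n, words growing on the left. *)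
Inductive homog : int -> X -> Prop :=
  | homog_sigma r : homog 0 (sigma r)
  | homog_T q : homog 1 (T q)
  | homog_S p : homog (-1) (S p)
  | homog0 n : homog n 0
  | homogB n x y : homog n x -> homog n y -> homog n (x - y)
  | homog_sigmaM r n x : homog n x -> homog n (sigma r ** x)
  | homog_TM q n x : homog n x -> homog (1 + n) (T q ** x)
  | homog_SM p n x : homog n x -> homog (-1 + n) (S p ** x).

Lemma homog_subgroup n : additive_subgroup (homog n).
Proof. by split; [exact: homog0 | exact: homogB]. Qed.

Lemma homogM m n x y : homog m x -> homog n y -> homog (m + n) (x ** y).
Proof.
move=> hx hy; elim: hx => {m x} [r|q|p|m|m x x' _ IH _ IH'|r m x _|q m x _|p m x _].
- by rewrite add0r; apply: homog_sigmaM.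
- exact: homog_TM.
- exact: homog_SM.
- by rewrite numul0r; apply: homog0.
- by rewrite numulBl; apply: homogB.
- by rewrite -numulA; apply: homog_sigmaM.
- by rewrite -numulA -addrA; apply: homog_TM.
- by rewrite -numulA -addrA; apply: homog_SM.
Qed.

(** Degrees add along words, so a grading of the target only has to be tested on generators. *)
Lemma homog_graded (B : nuRingType) (f : X -> B) (G : int -> set B) :
  nuring_morphism f -> Zgrading G ->
  (forall r, G 0 (f (sigma r))) -> (forall q, G 1 (f (T q))) ->
  (forall p, G (-1) (f (S p))) ->
  forall n x, homog n x -> G n (f x).
Proof.
move=> [fB fM] hG hs hT hS n x; elim=> {n x}; try by move=> *.
- by move=> n; rewrite zmod_morph0 //; have [] := Zgrading_subgroup hG n.
- move=> n x y _ hx _ hy; rewrite fB.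
  by case: (Zgrading_subgroup hG n) => _ GB; apply: GB.
- by move=> r n x _ hx; rewrite fM -[n]add0r; apply: (Zgrading_mul hG).
- by move=> q n x _ hx; rewrite fM; apply: (Zgrading_mul hG).
- by move=> p n x _ hx; rewrite fM; apply: (Zgrading_mul hG).
Qed.

Hypothesis surjX : surjective_covrep X.

Lemma homog_span x : exists (s : seq int) (c : int -> X),
  [/\ uniq s, forall n, homog n (c n) & x = \sum_(n <- s) c n].
Proof.
(* Degrees may repeat in the list; concatenations and products of lists then stay of the same kind,
   and [H] is a subring containing the generators. *)
pose H : set X := [set x | exists l : seq (int * X),
  (forall i, i \in l -> homog i.1 i.2) /\ x = \sum_(i <- l) i.2].
have HG n y : homog n y -> H y.
  move=> hy; exists [:: (n, y)]; split; last by rewrite big_seq1.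
  by move=> i; rewrite inE => /eqP ->.
have HB : additive_subgroup H.
  split; first by apply: (HG 0); apply: homog0.
  move=> _ _ [l [hl ->]] [l' [hl' ->]].
  exists (l ++ [seq (i.1, - i.2) | i <- l']); split.
    move=> i; rewrite mem_cat => /orP[/hl //|/mapP[j /hl' hj -> /=]].
    by rewrite -sub0r; apply: homogB => //; apply: homog0.
  by rewrite big_cat big_map sumrN.
have HM : nu_subring H.
  split=> // _ _ [l [hl ->]] [l' [hl' ->]].
  exists [seq (i.1 + j.1, i.2 ** j.2) | i <- l, j <- l']; split.
    move=> k /allpairsP[[i j] /= [hi hj ->]] /=.
    exact: homogM (hl _ hi) (hl' _ hj).
  rewrite big_allpairs_dep numul_suml; apply: eq_bigr => i _.
  by rewrite numul_sumr.
have [l [hl ->]] : H x.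
  rewrite (surjX HM) // => y [[|]|] [z _ <-]; apply: HG.
  - exact: homog_sigma.
  - exact: homog_T.
  - exact: homog_S.
(* Terms of equal degree are collected; a degree absent from [l] gets the empty sum 0. *)
exists (undup [seq i.1 | i <- l]), (fun n => \sum_(i <- l | i.1 == n) i.2).
split; first exact: undup_uniq.
  move=> n; rewrite big_seq_cond.
  apply: (big_ind (homog n)) => [|y z|i /andP[/hl hi /eqP <- //]].
    exact: homog0.
  exact: (additive_subgroupD (homog_subgroup n)).
rewrite (exchange_big_dep predT) //= big_seq [RHS]big_seq; apply: eq_bigr => i hi.
rewrite (eq_bigl (pred1 i.1)); last by move=> n; rewrite /= eq_sym.
by rewrite -big_filter filter_pred1_uniq ?big_seq1 ?undup_uniq // mem_undup map_f.
Qed.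

End Homogeneous.

(** * The shift representation and independence of degrees *)

Section Shift.
Variables (R : nuRingType) (sys : Rsystem R) (X : covrep sys).

Fact shift_subproof n (x : X) :
  zmod_morphism (fun (v : int -> X * int) m => uact x (v (m - n))).
Proof. by move=> v w; apply/funext => m; rewrite !fctE uactB. Qed.

(** The counterpart of the Laurent monomial x t^n: [x] acts on every entry while the index moves by
    [n]. *)
Definition shift n (x : X) : zmod_endo (int -> X * int) :=
  mk_endo (shift_subproof n x).

Lemma shiftB n : zmod_morphism (shift n).
Proof.
by move=> x y; apply: val_inj; apply/funext => v; apply/funext => m; exact: uactBl.
Qed.

Lemma shiftM m n x y : shift m x ** shift n y = shift (m + n) (x ** y).
Proof.
apply: val_inj; apply/funext => v; apply/funext => k /=.
by rewrite uactM opprD addrA.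
Qed.

Definition shift_covrep : covrep sys.
Proof.
refine (@MkCovrep _ sys (zmod_endo (int -> X * int)) (shift (-1) \o covS X)
  (shift 1 \o covT X) (shift 0 \o covsigma X) _ _ _ _ _ _ _ _).
- by move=> x y /=; rewrite covSB shiftB.
- by move=> x y /=; rewrite covTB shiftB.
- split=> x y /=; first by rewrite sigmaB shiftB.
  by rewrite shiftM sigmaM.
- by move=> p r /=; rewrite shiftM covS_ract.
- by move=> r p /=; rewrite shiftM covS_lact.
- by move=> p r /=; rewrite shiftM covT_ract.
- by move=> r p /=; rewrite shiftM covT_lact.
- by move=> p q /=; rewrite shiftM cov_psi.
Defined.

(** Both sides agree on generators, and by [shiftM] the right side is multiplicative with degrees
    adding; the image under [f] thus records the degree. *)
Lemma morph_shift (Y : covrep sys) (g : Y -> X) (f : Y -> shift_covrep) n y :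
  covrep_morphism g -> covrep_morphism f -> homog n y -> f y = shift n (g y).
Proof.
move=> hg hf; elim=> {n y}.
- by move=> r; rewrite !covrep_morph_sigma.
- by move=> q; rewrite !covrep_morphT.
- by move=> p; rewrite !covrep_morphS.
- move=> n; rewrite (zmod_morph0 (covrep_morphB hg)) (zmod_morph0 (covrep_morphB hf)).
  by rewrite (zmod_morph0 (@shiftB n)).
- by move=> n x y _ hx _ hy; rewrite !covrep_morphB // hx hy shiftB.
- move=> r n x _ hx; rewrite !covrep_morphM // hx !covrep_morph_sigma //.
  by rewrite shiftM add0r.
- by move=> q n x _ hx; rewrite !covrep_morphM // hx !covrep_morphT // shiftM.
- by move=> p n x _ hx; rewrite !covrep_morphM // hx !covrep_morphS // shiftM.
Qed.

Lemma shift_indep (s : seq int) (c : int -> X) : uniq s ->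
  \sum_(n <- s) shift n (c n) = 0 -> forall n, n \in s -> c n = 0.
Proof.
(* The adjoined unit placed at index 0: the summand of degree m moves it to index m, so entry [n] of
   the sum isolates [c n]. *)
move=> us hs n ns; pose v (m : int) : X * int := if m == 0 then (0, 1) else 0.
have : (\sum_(m <- s) val (shift m (c m)) v) n = 0.
  by rewrite -(zmod_morph_sum (endo_evalB v)) hs.
rewrite fct_sumE (bigD1_seq n) //= big1 ?addr0 => [|m nm].
  by rewrite /v subrr eqxx uact1 => -[].
by rewrite /v subr_eq0 eq_sym (negPf nm) (zmod_morph0 (@uactB _ _)).
Qed.

End Shift.

(** * Homomorphisms out of a quotient by a generated ideal *)

Section Quotient.
Variables A B : nuRingType.

Lemma ker_ideal (h : A -> B) : nuring_morphism h ->
  two_sided_ideal [set x | h x = 0].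
Proof.
move=> [hB hM]; split; first split=> [|x y /= hx hy]; first exact: zmod_morph0.
  by rewrite hB hx hy subrr.
by move=> a x /= hx; rewrite !hM hx numul0r numulr0.
Qed.

Lemma quot_lift (X : set A) (h : A -> B) : nuring_morphism h ->
  (forall x, X x -> h x = 0) ->
  exists f : ideal_quot X -> B,
    nuring_morphism f /\ forall x, f (quot_proj X x) = h x.
Proof.
move=> hh hX; have [hB hM] := hh.
pose f (u : ideal_quot X) : B := h (repr u).
have fE x : f (quot_proj X x) = h x.
  apply: subr0_eq; rewrite /f -hB.
  suff /(_ _ (ker_ideal hh)) : ideal_generated X (repr (quot_proj X x) - x) by apply.
  by apply/quot_proj_eq; rewrite /quot_proj reprK.
exists f; split=> //; split=> u v;
  have [x <-] := quot_proj_surj u; have [y <-] := quot_proj_surj v.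
  by rewrite -quot_proj_zmod_morphism !fE.
by rewrite -(quot_proj_morphism X).2 !fE.
Qed.

End Quotient.

(** * Finite-rank operators, their lifts, and local units from (FS) *)

Section ThetaSums.
Variables (R : nuRingType) (sys : Rsystem R).
Local Notation P := (sysP sys).
Local Notation Q := (sysQ sys).
Local Notation psi := (@psi R sys).
Implicit Types (w : seq (Q * P)) (X Y : covrep sys).

Definition theta_sum w : Q -> Q := fun x => \sum_(qp <- w) thetaQ qp.1 qp.2 x.

Definition TS_sum X w : X := \sum_(qp <- w) covT X qp.1 ** covS X qp.2.

Lemma FPQ_theta_sum w : FPQ (theta_sum w). Proof. by exists w. Qed.

Lemma ractBr (V : bimodType R) (v : V) : zmod_morphism (ract v : R -> V).
Proof. by move=> r s; apply: (addIr (v <* s)); rewrite -ractDr !addrNK. Qed.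

Lemma ractBl (V : bimodType R) (r : R) : zmod_morphism (fun v : V => v <* r).
Proof. by move=> v w; apply: (addIr (w <* r)); rewrite -ractDl !addrNK. Qed.

Lemma lactBl (V : bimodType R) (v : V) : zmod_morphism (fun r : R => r *> v).
Proof. by move=> r s; apply: (addIr (s *> v)); rewrite -lactDl !addrNK. Qed.

Lemma lactBr (V : bimodType R) (r : R) : zmod_morphism (lact r : V -> V).
Proof. by move=> v w; apply: (addIr (r *> w)); rewrite -lactDr !addrNK. Qed.

Lemma theta_sum_cat w v :
  theta_sum (w ++ v) = fun x => theta_sum w x + theta_sum v x.
Proof. by apply/funext => x; rewrite /theta_sum big_cat. Qed.

Lemma TS_sum_cat X w v : TS_sum X (w ++ v) = TS_sum X w + TS_sum X v.
Proof. by rewrite /TS_sum big_cat. Qed.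

Lemma theta_sum_neg w :
  theta_sum [seq (- qp.1, qp.2) | qp <- w] = fun x => - theta_sum w x.
Proof.
apply/funext => x; rewrite /theta_sum big_map -sumrN; apply: eq_bigr => -[q p] _ /=.
by rewrite /thetaQ -[- q]sub0r ractBl (zmod_morph0 (@ractBl _ _)) sub0r.
Qed.

Lemma TS_sum_neg X w : TS_sum X [seq (- qp.1, qp.2) | qp <- w] = - TS_sum X w.
Proof.
rewrite /TS_sum big_map -sumrN; apply: eq_bigr => -[q p] _ /=.
by rewrite -[- q]sub0r covTB (zmod_morph0 (@covTB _ _ _)) sub0r numulNr.
Qed.

Lemma theta_lift_sum X (pi : (Q -> Q) -> X) w :
  is_theta_lift pi -> pi (theta_sum w) = TS_sum X w.
Proof.
move=> [piD _ pi1]; elim: w => [|[q p] w IH].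
  (* The value of [pi] at the zero operator is forced to be 0 by additivity applied to 0 + 0 = 0. *)
  have e : theta_sum [::] \+ theta_sum [::] = theta_sum [::].
    by apply/funext => x /=; rewrite /theta_sum !big_nil addr0.
  have := piD _ _ (FPQ_theta_sum [::]) (FPQ_theta_sum [::]).
  by rewrite e /TS_sum big_nil -[LHS]addr0 => /addrI.
have -> : theta_sum ((q, p) :: w) = theta_sum [:: (q, p)] \+ theta_sum w.
  by apply/funext => x /=; rewrite /theta_sum big_cons big_seq1.
rewrite piD; try exact: FPQ_theta_sum.
rewrite IH /TS_sum big_cons; congr (_ + _); rewrite -pi1; congr (pi _).
by apply/funext => x; rewrite /theta_sum big_seq1.
Qed.

Lemma morph_TS_sum X Y (f : X -> Y) w :
  covrep_morphism f -> f (TS_sum X w) = TS_sum Y w.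
Proof.
move=> hf; rewrite /TS_sum (zmod_morph_sum (covrep_morphB hf)); apply: eq_bigr => qp _.
by rewrite covrep_morphM // covrep_morphT // covrep_morphS.
Qed.

Lemma homog_TS_sum X w : homog 0 (TS_sum X w).
Proof.
apply: additive_subgroup_sum; first exact: homog_subgroup.
by move=> qp; apply: (@homogM _ _ _ 1 (-1)); [exact: homog_T | exact: homog_S].
Qed.

Lemma TS_sum_T X w q : TS_sum X w ** covT X q = covT X (theta_sum w q).
Proof.
rewrite /TS_sum numul_suml (zmod_morph_sum (@covTB _ _ _)); apply: eq_bigr => qp _.
by rewrite -numulA -cov_psi -covT_ract.
Qed.

(** The sum on the right is an operator in F_Q(P) applied to [p]; by [theta_sum_psi] it is the
    adjoint of [theta_sum w] with respect to [psi]. *)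
Lemma S_TS_sum X w p :
  covS X p ** TS_sum X w = covS X (\sum_(qp <- w) psi p qp.1 *> qp.2).
Proof.
rewrite /TS_sum numul_sumr (zmod_morph_sum (@covSB _ _ _)); apply: eq_bigr => qp _.
by rewrite numulA -cov_psi -covS_lact.
Qed.

Lemma theta_sum_psi w p q :
  psi p (theta_sum w q) = psi (\sum_(qp <- w) psi p qp.1 *> qp.2) q.
Proof.
rewrite (zmod_morph_sum (psi_additiver p)) (zmod_morph_sum (psi_additivel q)).
by apply: eq_bigr => qp _; rewrite /thetaQ psi_ract psi_lact.
Qed.

Hypothesis hFS : condition_FS sys.

Lemma FS_left_unit (s : seq Q) :
  exists w, forall q, q \in s -> theta_sum w q = q.
Proof. by have [_ [_ [[w ->] _ hw _]]] := hFS s [::]; exists w. Qed.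

Lemma FS_right_unit (s : seq P) :
  exists w, forall p, p \in s -> \sum_(qp <- w) psi p qp.1 *> qp.2 = p.
Proof.
have [_ [_ [_ [w ->] _ hw]]] := hFS [::] s.
by exists [seq (pq.2, pq.1) | pq <- w] => p /hw {2}<-; rewrite big_map.
Qed.

(** A local unit writes [q] as a sum of terms q' psi(p', q), each of which vanishes. *)
Lemma psi_nondegenerater q : (forall p, psi p q = 0) -> q = 0.
Proof.
move=> hq; have [w hw] := FS_left_unit [:: q].
rewrite -(hw q) ?mem_head // /theta_sum big1 // => qp _.
by rewrite /thetaQ hq (zmod_morph0 (@ractBr _ _)).
Qed.

Lemma psi_nondegeneratel p : (forall q, psi p q = 0) -> p = 0.
Proof.
move=> hp; have [w hw] := FS_right_unit [:: p].
rewrite -(hw p) ?mem_head // big1 // => qp _.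
by rewrite hp (zmod_morph0 (@lactBl _ _)).
Qed.

(** The product is S of p r minus the adjoint of [theta_sum w] at [p]. This difference pairs to zero
    with every q, because r and [theta_sum w] act alike on Q, so it is zero by nondegeneracy. *)
Lemma Delta_kills_S X r w p : Delta r = theta_sum w ->
  covS X p ** (covsigma X r - TS_sum X w) = 0.
Proof.
move=> hr; rewrite numulBr S_TS_sum -covS_ract -covSB.
suff -> : p <* r - \sum_(qp <- w) psi p qp.1 *> qp.2 = 0.
  exact: (zmod_morph0 (@covSB _ _ _)).
apply: psi_nondegeneratel => q; rewrite psi_additivel -theta_sum_psi -hr.
by rewrite psi_balanced subrr.
Qed.

End ThetaSums.

(** * Universal property and grading of O(J) *)

Section CuntzPimsner.
Variables (R : nuRingType) (sys : Rsystem R) (T : covrep sys).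
Hypothesis hT : is_toeplitz T.
Variable pi : (sysQ sys -> sysQ sys) -> T.
Hypothesis hpi : is_theta_lift pi.
Variable J : set R.

Local Notation rho := (quot_proj (CP_relations pi J) : T -> CP pi J).

Lemma quot_proj_covrep : covrep_morphism rho.
Proof. by split=> //; exact: quot_proj_morphism. Qed.

Lemma CP_surjective : surjective_covrep (CP pi J).
Proof.
move=> H [HB HM] Hgen; have hr := quot_proj_covrep.
have hs : nu_subring [set x | H (rho x)].
  split; [split|] => [|x y hx hy|x y hx hy] /=.
  - by rewrite (zmod_morph0 (covrep_morphB hr)); case: HB.
  - by rewrite (covrep_morphB hr); case: HB => _; apply.
  - by rewrite (covrep_morphM hr); apply: HM.
apply/seteqP; split=> // u _; have [x <-] := quot_proj_surj u.
suff : [set x | H (rho x)] x by [].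
rewrite (hT.1 _ hs) // => y [[|]|] [z _ <-] /=; apply: Hgen.
- by left; left; exists z.
- by left; right; exists z.
- by right; exists z.
Qed.

Lemma CP_lift (Y : covrep sys) (h : T -> Y) : covrep_morphism h ->
  (forall r, J r -> h (covsigma T r) = h (pi (Delta r))) ->
  exists2 f : CP pi J -> Y, covrep_morphism f & forall x, f (rho x) = h x.
Proof.
move=> hh hJ; have hR : nuring_morphism h by case: hh.
have [|f [fm fE]] := @quot_lift _ _ (CP_relations pi J) h hR.
  by move=> _ [r Jr <-]; rewrite (covrep_morphB hh) hJ // subrr.
exists f => //; split=> //; apply/funext => x /=; rewrite fE.
- exact: covrep_morphT.
- exact: covrep_morphS.
- exact: covrep_morph_sigma.
Qed.

Hypothesis hcompat : psi_compatible sys J.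

Lemma CP_relation r : J r -> covsigma (CP pi J) r = rho (pi (Delta r)).
Proof.
move=> Jr; apply/quot_proj_eq => I _; apply; exists r => //.
Qed.

(** Spanning comes from surjectivity. For independence, the Toeplitz map to the shift representation
    of O(J) descends to O(J): both terms of a relator have degree 0 and agree in O(J), hence so do
    their shifts. On degree n the descended map is [shift n]. *)
Lemma CP_grading : Zgrading (@homog _ _ (CP pi J)).
Proof.
have hr := quot_proj_covrep.
split; [exact: homog_subgroup | exact: homogM | |].
  move=> x; have [s [c [_ hc ->]]] := homog_span CP_surjective x.
  by exists s, c.
have [h [hh _]] := hT.2 (shift_covrep (CP pi J)).
have [|f hf fE] := CP_lift hh.
  move=> r Jr; have [w hw] := hcompat Jr.
  rewrite (morph_shift hr hh (homog_sigma _ r)) (covrep_morph_sigma hr) CP_relation //.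
  rewrite hw theta_lift_sum //; exact/esym/(morph_shift hr hh)/homog_TS_sum.
have hid : covrep_morphism (id : CP pi J -> CP pi J) by [].
move=> s c us hc hs; apply: shift_indep => //.
under eq_bigr => n _ do rewrite -(morph_shift hid hf (hc n)).
by rewrite -(zmod_morph_sum (covrep_morphB hf)) hs (zmod_morph0 (covrep_morphB hf)).
Qed.

Lemma CP_covrep_grading : covrep_grading (@homog _ _ (CP pi J)).
Proof.
split; first exact: CP_grading; move=> _ [x _ <-].
- exact: homog_sigma.
- exact: homog_T.
- exact: homog_S.
Qed.

End CuntzPimsner.

(** * Normal forms of homogeneous elements and kernels of homomorphisms *)

Section NormalForm.
Variables (R : nuRingType) (sys : Rsystem R) (X : covrep sys).
Local Notation P := (sysP sys).
Local Notation Q := (sysQ sys).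
Local Notation psi := (@psi R sys).
Local Notation sigma := (covsigma X).
Local Notation T := (covT X).
Local Notation S := (covS X).

(* Sums of elements of Q^(a-i) P^(b-i), i <= min(a, b), with Q^0 P^0 = R. *)
Inductive nf : nat -> nat -> X -> Prop :=
  | nf_sigma r : nf 0 0 (sigma r)
  | nf_T q : nf 1 0 (T q)
  | nf_S p : nf 0 1 (S p)
  | nf0 a b : nf a b 0
  | nfB a b x y : nf a b x -> nf a b y -> nf a b (x - y)
  | nf_TM q a b x : nf a b x -> nf a.+1 b (T q ** x)
  | nf_MS p a b x : nf a b x -> nf a b.+1 (x ** S p)
  | nf_succ a b x : nf a b x -> nf a.+1 b.+1 x.

Lemma nf_add k a b x : nf a b x -> nf (a + k) (b + k) x.
Proof. by move=> h; elim: k => [|k IH]; rewrite ?addn0 // !addnS; apply: nf_succ. Qed.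

Lemma nf_sigmaM r a b x : nf a b x -> nf a b (sigma r ** x).
Proof.
elim=> {a b x} [s|q|p|a b|a b x y _ IH _ IH'|q a b x h _|p a b x _ IH|a b x _ IH].
- by rewrite -sigmaM; apply: nf_sigma.
- by rewrite -covT_lact; apply: nf_T.
- by rewrite -covS_lact; apply: nf_S.
- by rewrite numulr0; apply: nf0.
- by rewrite numulBr; apply: nfB.
- by rewrite numulA -covT_lact; apply: nf_TM.
- by rewrite numulA; apply: nf_MS.
- exact: nf_succ.
Qed.

Lemma nf_Msigma r a b x : nf a b x -> nf a b (x ** sigma r).
Proof.
elim=> {a b x} [s|q|p|a b|a b x y _ IH _ IH'|q a b x _ IH|p a b x h _|a b x _ IH].
- by rewrite -sigmaM; apply: nf_sigma.
- by rewrite -covT_ract; apply: nf_T.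
- by rewrite -covS_ract; apply: nf_S.
- by rewrite numul0r; apply: nf0.
- by rewrite numulBl; apply: nfB.
- by rewrite -numulA; apply: nf_TM.
- by rewrite -numulA -covS_ract; apply: nf_MS.
- exact: nf_succ.
Qed.

(** [S p] cancels a leading letter of Q through [psi]; at a = 0 there is none to cancel and the word
    in P grows instead. *)
Lemma nf_SM p a b x :
  nf a b x -> nf a.-1 (if a == 0%N then b.+1 else b) (S p ** x).
Proof.
elim=> {a b x} [s|q|p'|a b|a b x y _ IH _ IH'|q a b x h _|p' a b x _ IH|a b x _ IH] /=.
- by rewrite -covS_ract; apply: nf_S.
- by rewrite -cov_psi; apply: nf_sigma.
- by apply: nf_MS; apply: nf_S.
- by rewrite numulr0; apply: nf0.
- by rewrite numulBr; apply: nfB.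
- by rewrite numulA -cov_psi; apply: nf_sigmaM.
- by rewrite numulA; case: a IH => [|a] IH; apply: nf_MS.
- by case: a IH => [|a] IH //; apply: nf_succ.
Qed.

Lemma nf_MT q a b x :
  nf a b x -> nf (if b == 0%N then a.+1 else a) b.-1 (x ** T q).
Proof.
elim=> {a b x} [s|q'|p|a b|a b x y _ IH _ IH'|q' a b x _ IH|p a b x h _|a b x _ IH] /=.
- by rewrite -covT_lact; apply: nf_T.
- by apply: nf_TM; apply: nf_T.
- by rewrite -cov_psi; apply: nf_sigma.
- by rewrite numul0r; apply: nf0.
- by rewrite numulBl; apply: nfB.
- by rewrite -numulA; case: b IH => [|b] IH; apply: nf_TM.
- by rewrite -numulA -cov_psi; apply: nf_Msigma.
- by case: b IH => [|b] IH //; apply: nf_succ.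
Qed.

Lemma homog_nf n x : homog n x -> exists a b : nat, n = a%:Z - b%:Z /\ nf a b x.
Proof.
elim=> {n x}.
- by move=> r; exists 0%N, 0%N; split=> //; apply: nf_sigma.
- by move=> q; exists 1%N, 0%N; split=> //; apply: nf_T.
- by move=> p; exists 0%N, 1%N; split=> //; apply: nf_S.
- case=> k; first by exists k, 0%N; rewrite subr0; split=> //; apply: nf0.
  by exists 0%N, k.+1; rewrite sub0r NegzE; split=> //; apply: nf0.
- move=> n x y _ [a [b [-> hx]]] _ [c [d [e hy]]].
  (* The two shapes satisfy a - b = c - d; padding the first by c and the second by a gives a common
     shape. *)
  exists (a + c)%N, (b + c)%N; split; first by rewrite !PoszD opprD addrACA subrr addr0.
  apply: nfB; first exact: nf_add.
  rewrite addnC; suff -> : (b + c = d + a)%N by apply: nf_add.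
  apply/eqP; rewrite -eqz_nat !PoszD; apply/eqP.
  by move/eqP: e; rewrite subr_eq addrAC eq_sym subr_eq addrC => /eqP ->; rewrite addrC.
- by move=> r n x _ [a [b [-> hx]]]; exists a, b; split=> //; apply: nf_sigmaM.
- move=> q n x _ [a [b [-> hx]]]; exists a.+1, b; split; last exact: nf_TM.
  by rewrite -addn1 PoszD addrA [1 + _]addrC.
- move=> p n x _ [a [b [-> /(nf_SM p)]]].
  case: a => [|a] /= h; [exists 0%N, b.+1 | exists a, b]; split=> //.
    by rewrite -addn1 PoszD opprD !addrA addr0 add0r addrC.
  by rewrite -addn1 PoszD addrA [-1 + _]addrC addrK.
Qed.

(** Quantifying over all local units of a finite set, rather than choosing one, lets a difference be
    absorbed by taking the union of two finite sets. *)
Definition left_absorbed x := exists s : seq Q, forall w,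
  (forall q, q \in s -> theta_sum w q = q) -> TS_sum X w ** x = x.

Definition right_absorbed x := exists s : seq P, forall w,
  (forall p, p \in s -> \sum_(qp <- w) psi p qp.1 *> qp.2 = p) ->
  x ** TS_sum X w = x.

Lemma left_absorbed0 : left_absorbed 0.
Proof. by exists [::] => w _; rewrite numulr0. Qed.

Lemma right_absorbed0 : right_absorbed 0.
Proof. by exists [::] => w _; rewrite numul0r. Qed.

Lemma left_absorbedB x y :
  left_absorbed x -> left_absorbed y -> left_absorbed (x - y).
Proof.
move=> [s hs] [t ht]; exists (s ++ t) => w hw; rewrite numulBr.
by rewrite hs ?ht // => q hq; apply: hw; rewrite mem_cat hq ?orbT.
Qed.

Lemma right_absorbedB x y :
  right_absorbed x -> right_absorbed y -> right_absorbed (x - y).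
Proof.
move=> [s hs] [t ht]; exists (s ++ t) => w hw; rewrite numulBl.
by rewrite hs ?ht // => q hq; apply: hw; rewrite mem_cat hq ?orbT.
Qed.

Lemma left_absorbed_T q : left_absorbed (T q).
Proof. by exists [:: q] => w hw; rewrite TS_sum_T hw ?mem_head. Qed.

Lemma right_absorbed_S p : right_absorbed (S p).
Proof. by exists [:: p] => w hw; rewrite S_TS_sum hw ?mem_head. Qed.

Lemma left_absorbedM x y : left_absorbed x -> left_absorbed (x ** y).
Proof. by move=> [s hs]; exists s => w hw; rewrite numulA hs. Qed.

Lemma right_absorbedM x y : right_absorbed x -> right_absorbed (y ** x).
Proof. by move=> [s hs]; exists s => w hw; rewrite -numulA hs. Qed.

(** An excess of letters of Q makes every word begin with some [T q]: [nf_succ] preserves the strict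
    inequality, and elements of R enter only at a = b = 0. *)
Lemma nf_left_absorbed a b x : nf a b x -> (b < a)%N -> left_absorbed x.
Proof.
elim=> {a b x} //.
- by move=> q _; apply: left_absorbed_T.
- by move=> a b _; apply: left_absorbed0.
- by move=> a b x y _ IH _ IH' h; apply: left_absorbedB; auto.
- by move=> q a b x _ _ _; apply: left_absorbedM; apply: left_absorbed_T.
- by move=> p a b x _ IH h; apply: left_absorbedM; apply: IH; apply: ltnW.
Qed.

Lemma nf_right_absorbed a b x : nf a b x -> (a < b)%N -> right_absorbed x.
Proof.
elim=> {a b x} //.
- by move=> q _; apply: right_absorbed_S.
- by move=> a b _; apply: right_absorbed0.
- by move=> a b x y _ IH _ IH' h; apply: right_absorbedB; auto.
- by move=> p a b x _ IH h; apply: right_absorbedM; apply: IH; apply: ltnW.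
- by move=> q a b x _ _ _; apply: right_absorbedM; apply: right_absorbed_S.
Qed.

(** In a diagonal word T(q) x the factor x has more letters of P than of Q, hence is absorbed on the
    right; symmetrically for x S(p). Only the contributions of R escape, and they are gathered in
    [sigma r]. *)
Lemma nf_diag a x : nf a a x ->
  exists r y, [/\ x = sigma r + y, left_absorbed y & right_absorbed y].
Proof.
have sigma0 : sigma 0 = 0 by apply: zmod_morph0; apply: sigmaB.
have absorbed y : left_absorbed y -> right_absorbed y ->
    exists r z, [/\ y = sigma r + z, left_absorbed z & right_absorbed z].
  by exists 0, y; rewrite sigma0 add0r.
move E: {2}a => b h; elim: h E => {x b} [r|q|p|b c|b c x y _ IH _ IH'|q b c x h _|p b c x h _|b c x _ IH] E //.
- exists r, 0; rewrite addr0; split=> //; [exact: left_absorbed0 | exact: right_absorbed0].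
- by apply: absorbed; [exact: left_absorbed0 | exact: right_absorbed0].
- have [r [x' [-> lx rx]]] := IH E; have [s [y' [-> ly ry]]] := IH' E.
  exists (r - s), (x' - y'); split; first by rewrite sigmaB opprD addrACA.
    exact: left_absorbedB.
  exact: right_absorbedB.
- apply: absorbed; first by apply: left_absorbedM; apply: left_absorbed_T.
  by apply: right_absorbedM; apply: nf_right_absorbed h _; rewrite -E.
- apply: absorbed; last by apply: right_absorbedM; apply: right_absorbed_S.
  by apply: left_absorbedM; apply: nf_left_absorbed h _; rewrite E.
- by case: E => E; apply: IH.
Qed.

Lemma nf00 x : nf 0 0 x -> exists r, x = sigma r.
Proof.
move E: {1}0%N => a; move E': 0%N => b h; elim: h E E' => {a b x} //.
- by move=> r _ _; exists r.
- by move=> a b _ _; exists 0; rewrite (zmod_morph0 (@sigmaB _ _ _)).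
- move=> a b x y _ IH _ IH' E E'.
  have [r ->] := IH E E'; have [s ->] := IH' E E'.
  by exists (r - s); rewrite sigmaB.
Qed.

Hypothesis hFS : condition_FS sys.

Variables (B : nuRingType) (f : X -> B).
Hypothesis fm : nuring_morphism f.
Hypothesis f_sigma : forall r, f (sigma r) = 0 -> r = 0.
Hypothesis f_coisometry : forall r w, Delta r = theta_sum w ->
  f (sigma r - TS_sum X w) = 0 -> sigma r - TS_sum X w = 0.

Let fB : zmod_morphism f := fm.1.
Let fM : {morph f : x y / x ** y} := fm.2.

Let f_T q : f (T q) = 0 -> q = 0.
Proof.
move=> h; apply: psi_nondegenerater => // p; apply: f_sigma.
by rewrite cov_psi fM h numulr0.
Qed.

Lemma nf_ker a b x : nf a b x -> f x = 0 -> x = 0.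
Proof.
have [n] := ubnP (a + b); elim: n => // n IH in a b x * => hn hx fx.
have [lt_ba|lt_ab|e_ab] := ltngtP b a.
(* A local unit expands x as a sum of terms T(q) S(p) x, where S(p) x is an element of the kernel of
   smaller total length. *)
- have [s hs] := nf_left_absorbed hx lt_ba; have [w hw] := FS_left_unit hFS s.
  rewrite -(hs w hw) /TS_sum numul_suml big1 // => qp _; rewrite -numulA.
  suff -> : S qp.2 ** x = 0 by rewrite numulr0.
  apply: (IH a.-1 b); last by rewrite fM fx numulr0.
    by rewrite -ltnS in hn *; case: (a) lt_ba hn.
  by have := nf_SM qp.2 hx; case: (a) lt_ba.
- have [s hs] := nf_right_absorbed hx lt_ab; have [w hw] := FS_right_unit hFS s.
  rewrite -(hs w hw) /TS_sum numul_sumr big1 // => qp _; rewrite numulA.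
  suff -> : x ** T qp.1 = 0 by rewrite numul0r.
  apply: (IH a b.-1); last by rewrite fM fx numul0r.
    by case: (b) lt_ab hn => // c _; rewrite addnS.
  by have := nf_MT qp.1 hx; case: (b) lt_ab.
subst b; case: a => [|a] in hn hx *.
  by have [r e] := nf00 hx; move: fx; rewrite e => /f_sigma ->; apply: zmod_morph0; apply: sigmaB.
have SxT p q : S p ** x ** T q = 0.
  apply: (IH a a); last by rewrite !fM fx numulr0 numul0r.
    by move: hn; rewrite addSn addnS !ltnS => /ltnW.
  by have := nf_MT q (nf_SM p hx).
have [r [y [ex [s hs] [t ht]]]] := nf_diag hx.
have [w hw] := FS_left_unit hFS s; have [v hv] := FS_right_unit hFS t.
(* With e, e' the lifts of [w] and [v], expanding e (sigma r + y) e' = 0 gives y = - e (sigma r) e'.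
   The middle product S(p) sigma(r) T(q) equals sigma of psi(p, r q), which yields the entries of
   [u]. *)
pose u := [seq (- (i.1 <* psi i.2 (r *> j.1)), j.2) | i <- w, j <- v].
have ey : y = TS_sum X u.
  have : TS_sum X w ** x ** TS_sum X v = 0.
    rewrite /TS_sum !numul_suml big1 // => i _; rewrite numul_sumr big1 // => j _.
    by rewrite numulA -[_ ** x]numulA -[_ ** T _]numulA SxT numulr0 numul0r.
  rewrite ex numulDr numulDl hs // ht // => /eqP.
  rewrite addrC addr_eq0 => /eqP ->.
  rewrite /TS_sum numul_suml big_allpairs_dep numul_suml -sumrN.
  apply: eq_bigr => i _; rewrite numul_sumr -sumrN; apply: eq_bigr => j _ /=.
  rewrite (zmod_morphN (@covTB _ _ _)) numulNr covT_ract; congr (- _).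
  by rewrite cov_psi covT_lact !numulA.
(* From f(x T(q)) = 0 and injectivity of f on T(Q), r q plus the value of [theta_sum u] at q
   vanishes; hence the sign change. *)
have hr : Delta r = theta_sum [seq (- i.1, i.2) | i <- u].
  rewrite theta_sum_neg; apply/funext => q; apply/eqP; rewrite -addr_eq0.
  apply/eqP/f_T; rewrite (zmod_morphD (@covTB _ _ _)) covT_lact -TS_sum_T -numulDl.
  by rewrite -ey -ex fM fx numul0r.
have xE : x = sigma r - TS_sum X [seq (- i.1, i.2) | i <- u].
  by rewrite TS_sum_neg opprK ex ey.
by rewrite xE; apply: f_coisometry => //; rewrite -xE.
Qed.

End NormalForm.

(** * The Fock representation on multilinear functions *)

Section Fock.
Variables (R : nuRingType) (sys : Rsystem R).
Local Notation P := (sysP sys).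
Local Notation Q := (sysQ sys).
Local Notation psi := (@psi R sys).
Local Notation pre_fock := (seq P -> R * int).
Implicit Type phi : pre_fock.

(** A function of p_1, ..., p_n stands in for a tensor of n elements of Q evaluated against the p_i.
    Since psi(p, r q) = psi(p r, q), R acts through the first entry. *)
Definition fock_R (r : R) phi : pre_fock := fun w =>
  if w is p :: w' then phi (p <* r :: w') else uact r (phi [::]).

Definition fock_S (p : P) phi : pre_fock := fun w => phi (p :: w).

Definition fock_T (q : Q) phi : pre_fock := fun w =>
  if w is p :: w' then fock_R (psi p q) phi w' else 0.

(** In the second clause r leaves an entry and multiplies the next one on the right, which is
    balancedness over p_n ⊗ ... ⊗ p_1; at the last entry r acts on the value. *)
Definition multilinear phi := forall u p,
  (forall p' w, phi (u ++ (p - p') :: w) = phi (u ++ p :: w) - phi (u ++ p' :: w)) /\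
  (forall r w, phi (u ++ r *> p :: w) = fock_R r (fun w => phi (u ++ p :: w)) w).

Lemma fock_RB r : zmod_morphism (fock_R r).
Proof. by move=> phi chi; apply/funext => -[|p w] //; exact: uactB. Qed.

Lemma fock_SB p : zmod_morphism (fock_S p).
Proof. by []. Qed.

Lemma fock_TB q : zmod_morphism (fock_T q).
Proof.
move=> phi chi; apply/funext => -[|p w]; first exact/esym/(subrr (0 : R * int)).
exact: (congr1 (fun h : pre_fock => h w) (fock_RB (psi p q) phi chi)).
Qed.

Lemma fock_RM r s phi : fock_R (r ** s) phi = fock_R r (fock_R s phi).
Proof. by apply/funext => -[|p w] /=; rewrite ?uactM ?ractA. Qed.

Lemma multilinear_S p phi : multilinear phi -> multilinear (fock_S p phi).
Proof. by move=> h u; apply: (h (p :: u)). Qed.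

Lemma multilinear_R r phi : multilinear phi -> multilinear (fock_R r phi).
Proof.
move=> h [|p u] p'; last exact: (h (p <* r :: u)).
split=> [p'' w|s w] /=; first by rewrite ractBl (h [::] _).1.
by rewrite lractA (h [::] _).2; case: w.
Qed.

Lemma fock_RBl phi w : multilinear phi -> zmod_morphism (fun r => fock_R r phi w).
Proof.
by move=> h r s; case: w => [|p w] /=; rewrite ?uactBl // ractBr (h [::] _).1.
Qed.

Lemma multilinear_T q phi : multilinear phi -> multilinear (fock_T q phi).
Proof.
move=> h [|p u] p'; last exact: (multilinear_R (psi p q) h u).
split=> [p'' w|s w] /=; first by rewrite psi_additivel fock_RBl.
by rewrite psi_lact fock_RM; case: w.
Qed.

Definition fock_pred : {pred pre_fock} := fun phi => `[< multilinear phi >].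

Fact fock_zmod_closed : zmod_closed fock_pred.
Proof.
split.
  by apply/asboolP => u p; split=> [p' w|r w]; rewrite ?subrr //;
    case: w => [|p' w] //=; rewrite (zmod_morph0 (@uactB _ _)).
move=> phi chi /asboolP h /asboolP k; apply/asboolP => u p; split=> [p' w|r w].
  by rewrite !fctE (h u p).1 (k u p).1 !opprD addrACA.
by rewrite !fctE (h u p).2 (k u p).2 -[LHS]/((_ - _ : pre_fock) w) -fock_RB.
Qed.

HB.instance Definition _ :=
  GRing.isZmodClosed.Build pre_fock fock_pred fock_zmod_closed.

Record fock : Type := Fock { fock_val : pre_fock; _ : fock_val \in fock_pred }.

HB.instance Definition _ := [isSub of fock for fock_val].
HB.instance Definition _ := [Choice of fock by <:].
HB.instance Definition _ := [SubChoice_isSubZmodule of fock by <:].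

Lemma fock_multilinear (v : fock) : multilinear (val v).
Proof. exact/asboolP/(valP v). Qed.

Section Lift.
Variable g : pre_fock -> pre_fock.
Hypotheses (gB : zmod_morphism g) (gP : forall phi, multilinear phi -> multilinear (g phi)).

Definition fock_lift_fun (v : fock) : fock :=
  Fock (introT (asboolP _) (gP (fock_multilinear v)) : g (val v) \in fock_pred).

Fact fock_lift_subproof : zmod_morphism fock_lift_fun.
Proof. by move=> v w; apply: val_inj => /=; exact: gB. Qed.

Definition fock_lift : zmod_endo fock := mk_endo fock_lift_subproof.

End Lift.

Definition fock_covR r := fock_lift (@fock_RB r) (@multilinear_R r).
Definition fock_covS p := fock_lift (@fock_SB p) (@multilinear_S p).
Definition fock_covT q := fock_lift (@fock_TB q) (@multilinear_T q).

Lemma fock_endoP (f g : zmod_endo fock) :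
  (forall v w, val (val f v) w = val (val g v) w) -> f = g.
Proof.
move=> h; apply: val_inj; apply/funext => v; apply: val_inj; apply/funext => w.
exact: h.
Qed.

Lemma fock_evalB v w : zmod_morphism (fun f : zmod_endo fock => val (val f v) w).
Proof. by []. Qed.

(** The two clauses of [multilinear] give additivity of S and S(r p) = sigma(r) S(p); the relation
    S(p) T(q) = sigma(psi(p, q)) holds by computation. *)
Definition fock_covrep : covrep sys.
Proof.
refine (@MkCovrep _ sys (zmod_endo fock) fock_covS fock_covT fock_covR
  _ _ _ _ _ _ _ _).
- move=> p p'; apply: fock_endoP => v w.
  exact: (fock_multilinear v [::] p).1.
- move=> q q'; apply: fock_endoP => v [|p w] /=; first exact/esym/(subrr (0 : R * int)).
  by rewrite psi_additiver; apply: fock_RBl; apply: fock_multilinear.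
- split=> r s; apply: fock_endoP => v w /=.
    by apply: fock_RBl; apply: fock_multilinear.
  by rewrite fock_RM.
- by move=> p r; apply: fock_endoP => v w.
- move=> r p; apply: fock_endoP => v w.
  exact: (fock_multilinear v [::] p).2.
- move=> q r; apply: fock_endoP => v [|p w] //=.
  by rewrite psi_ract fock_RM.
- move=> r q; apply: fock_endoP => v [|p w] /=.
    by rewrite (zmod_morph0 (@uactB _ _)).
  by rewrite psi_balanced.
- by move=> p q; apply: fock_endoP => v w.
Defined.

Definition vacuum_fun : pre_fock := fun w => if w is [::] then (0, 1) else 0.

Fact vacuum_subproof : vacuum_fun \in fock_pred.
Proof.
apply/asboolP => -[|p u] p'; split=> [p'' w|r [|p'' w]] //=; rewrite ?subrr //;
 by rewrite (zmod_morph0 (@uactB _ _)).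
Qed.

Definition vacuum : fock := Fock vacuum_subproof.

End Fock.

(** * Multiples of finite-rank operators and their lifts by elements of R *)

Lemma theta_sum_mull (R : nuRingType) (sys : Rsystem R) r w :
  theta_sum [seq (r *> qp.1, qp.2) | qp <- w] =
  (fun x : sysQ sys => r *> theta_sum w x).
Proof.
apply/funext => x; rewrite /theta_sum big_map (zmod_morph_sum (@lactBr _ _ r)).
by apply: eq_bigr => qp _; rewrite /thetaQ lractA.
Qed.

Lemma theta_sum_mulr (R : nuRingType) (sys : Rsystem R) r w :
  theta_sum [seq (qp.1, qp.2 <* r) | qp <- w] =
  (fun x : sysQ sys => theta_sum w (r *> x)).
Proof.
apply/funext => x; rewrite /theta_sum big_map.
by apply: eq_bigr => qp _; rewrite /thetaQ psi_balanced.
Qed.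

Lemma TS_sum_mull (R : nuRingType) (sys : Rsystem R) (X : covrep sys) r w :
  TS_sum X [seq (r *> qp.1, qp.2) | qp <- w] = covsigma X r ** TS_sum X w.
Proof.
rewrite /TS_sum big_map numul_sumr.
by apply: eq_bigr => qp _; rewrite numulA covT_lact.
Qed.

Lemma TS_sum_mulr (R : nuRingType) (sys : Rsystem R) (X : covrep sys) r w :
  TS_sum X [seq (qp.1, qp.2 <* r) | qp <- w] = TS_sum X w ** covsigma X r.
Proof.
rewrite /TS_sum big_map numul_suml.
by apply: eq_bigr => qp _; rewrite -numulA covS_ract.
Qed.

(** * The ideal of relations and its vacuum coefficients *)

Section RelationIdeal.
Variables (R : nuRingType) (sys : Rsystem R) (X : covrep sys).
Hypothesis hFS : condition_FS sys.
Variable J : set R.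
Hypothesis hJ : two_sided_ideal J.
Local Notation sigma := (covsigma X).
Local Notation T := (covT X).
Local Notation S := (covS X).

(* The right ideal spanned by the q_1 ... q_b (r - pi (Delta r)) y, b < a. *)
Inductive relspan : nat -> X -> Prop :=
  | relspan0 a : relspan a 0
  | relspanB a x y : relspan a x -> relspan a y -> relspan a (x - y)
  | relspan_rel a r w : J r -> Delta r = theta_sum w ->
      relspan a.+1 (sigma r - TS_sum X w)
  | relspan_TM a q x : relspan a x -> relspan a.+1 (T q ** x)
  | relspan_M a x y : relspan a x -> relspan a (x ** y)
  | relspan_succ a x : relspan a x -> relspan a.+1 x.

Lemma relspan_add b a x : relspan a x -> relspan (a + b) x.
Proof. by elim: b => [|b IH] h; rewrite ?addn0 // addnS; apply/relspan_succ/IH. Qed.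

Lemma relspan_eq0 x : relspan 0 x -> x = 0.
Proof.
move E: 0%N => a h; elim: h E => {a x} //.
- by move=> a x y _ IH _ IH' e; rewrite IH // IH' // subrr.
- by move=> a x y _ IH e; rewrite IH // numul0r.
Qed.

Lemma relspan_sigmaM r a x : relspan a x -> relspan a (sigma r ** x).
Proof.
elim=> {a x} [a|a x y _ IH _ IH'|a s w Js hs|a q x h _|a x y _ IH|a x _ IH].
- by rewrite numulr0; apply: relspan0.
- by rewrite numulBr; apply: relspanB.
- rewrite numulBr -sigmaM -TS_sum_mull; apply: relspan_rel.
    by case: (hJ.2 r s Js).
  by rewrite theta_sum_mull -hs; apply/funext => q; exact: lactA.
- by rewrite numulA -covT_lact; apply: relspan_TM.
- by rewrite numulA; apply: relspan_M.
- exact: relspan_succ.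
Qed.

(** [S p] annihilates a relator by [Delta_kills_S] and turns a leading [T q] into an element of R,
    so the level drops by one. *)
Lemma relspan_SM p a x : relspan a x -> relspan a.-1 (S p ** x).
Proof.
elim=> {a x} [a|a x y _ IH _ IH'|a s w Js hs|a q x h _|a x y _ IH|[|a] x h IH] //=.
- by rewrite numulr0; apply: relspan0.
- by rewrite numulBr; apply: relspanB.
- by rewrite Delta_kills_S //; apply: relspan0.
- by rewrite numulA -cov_psi; apply: relspan_sigmaM.
- by rewrite numulA; apply: relspan_M.
- exact: relspan_succ.
Qed.

Lemma relspan_ideal : surjective_covrep X ->
  two_sided_ideal [set x | exists a, relspan a x].
Proof.
have HB x y : (exists a, relspan a x) -> (exists a, relspan a y) ->
    exists a, relspan a (x - y).
  move=> [a hx] [b hy]; exists (a + b)%N; apply: relspanB; first exact: relspan_add.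
  by rewrite addnC; apply: relspan_add.
move=> surjX; split; first by split; [exists 0%N; apply: relspan0 | exact: HB].
move=> y x [a hx]; split; last by exists a; apply: relspan_M.
(* Stability under left multiplication is checked on generators, since the elements preserving the
   span form a subring. The level may rise or fall, so [b] is existential. *)
pose H := [set y | forall x a, relspan a x -> exists b, relspan b (y ** x)].
suff : H y by apply; exact: hx.
have hH : nu_subring H.
  split; [split|] => [z b|u v hu hv z b hz|u v hu hv z b hz] /=.
  - by move=> _; exists 0%N; rewrite numul0r; apply: relspan0.
  - by rewrite numulBl; apply: HB; [apply: hu hz | apply: hv hz].
  - by rewrite -numulA; have [c hc] := hv _ _ hz; apply: hu hc.
rewrite (surjX _ hH) // => _ [[|]|] [u _ <-] z b hz.
- by exists b; apply: relspan_sigmaM.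
- by exists b.+1; apply: relspan_TM.
- by exists b.-1; apply: relspan_SM.
Qed.

Lemma ideal_mulz r (n : int) : J r -> J (r *~ n).
Proof.
move=> Jr; have [hB _] := hJ; have h0 := hB.1.
have hn m : J (r *+ m).
  by elim: m => [|m IH]; rewrite ?mulr0n // mulrS; apply: additive_subgroupD.
case: n => m; first exact: hn.
by rewrite NegzE mulrNz -sub0r; apply: hB.2 => //; apply: hn.
Qed.

Variable h : X -> fock_covrep sys.
Hypothesis hh : covrep_morphism h.

Definition vacuum_coef (x : X) (v : fock sys) : R * int := val (val (h x) v) [::].

Lemma vacuum_coefB v : zmod_morphism (vacuum_coef^~ v).
Proof.
move=> x y; rewrite /vacuum_coef (covrep_morphB hh).
exact: (fock_evalB v [::] (h x) (h y)).
Qed.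

Lemma vacuum_coef_sigma r v : vacuum_coef (sigma r) v = uact r (val v [::]).
Proof. by rewrite /vacuum_coef covrep_morph_sigma. Qed.

Lemma vacuum_coef_TM q x v : vacuum_coef (T q ** x) v = 0.
Proof. by rewrite /vacuum_coef covrep_morphM // covrep_morphT. Qed.

Lemma vacuum_coef_TS_sum w v : vacuum_coef (TS_sum X w) v = 0.
Proof.
rewrite (zmod_morph_sum (vacuum_coefB v)) big1 // => qp _.
exact: vacuum_coef_TM.
Qed.

(** Vectors in the image of T(Q) vanish at the empty sequence, so a relator contributes only r
    acting on the value of [v] there, which stays in the ideal [J]. A right factor merely changes
    [v], which is therefore kept general in the induction. *)
Lemma relspan_vacuum a x v : relspan a x ->
  exists2 r, J r & vacuum_coef x v = (r, 0).
Proof.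
have [[J0 JB] JM] := hJ.
move=> hx; elim: hx v => {a x}
  [a|a x y _ IH _ IH'|a s w Js hs|a q x _ _|a x y _ IH|a x _ IH] v //.
- by exists 0 => //; rewrite (zmod_morph0 (vacuum_coefB v)).
- have [r Jr er] := IH v; have [s Js es] := IH' v.
  exists (r - s); first exact: JB.
  by rewrite vacuum_coefB er es; congr (_, _); rewrite subr0.
- rewrite vacuum_coefB vacuum_coef_TS_sum vacuum_coef_sigma subr0.
  exists (s ** (val v [::]).1 + s *~ (val v [::]).2) => //.
  apply: additive_subgroupD; [by case: hJ | by case: (JM (val v [::]).1 s Js) |].
  exact: ideal_mulz.
- by exists 0 => //; rewrite vacuum_coef_TM.
- have [r Jr e] := IH (val (h y) v); exists r => //.
  by rewrite -e /vacuum_coef covrep_morphM.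
Qed.

Lemma relspan_rel_mem a r w : relspan a (sigma r - TS_sum X w) -> J r.
Proof.
move=> /(relspan_vacuum (vacuum sys)) [s Js].
by rewrite vacuum_coefB vacuum_coef_TS_sum vacuum_coef_sigma subr0 uact1 => -[->].
Qed.

(** The vacuum puts r in [J]. Moreover S(p) sigma(r) T(q) is sigma of psi(p, r q) and lies one level
    lower, so by induction r annihilates Q, and faithfulness gives r = 0. At level zero the vacuum
    recovers r from sigma r = 0. *)
Lemma relspan_sigma a r : (forall s, J s -> Delta s = (fun _ : sysQ sys => 0) -> s = 0) ->
  relspan a (sigma r) -> r = 0.
Proof.
move=> faithJ; elim: a r => [|a IH] r hr.
  have := vacuum_coef_sigma r (vacuum sys).
  rewrite (relspan_eq0 hr) (zmod_morph0 (vacuum_coefB _)) uact1.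
  by move=> -[].
apply: faithJ.
  have [s Js] := relspan_vacuum (vacuum sys) hr.
  by rewrite vacuum_coef_sigma uact1 => -[->].
apply/funext => q; apply: psi_nondegenerater => // p; apply: IH.
by rewrite cov_psi covT_lact numulA; apply: relspan_M; exact: (relspan_SM p hr).
Qed.

End RelationIdeal.

(** * The ideal on which a homomorphism satisfies the Cuntz-Pimsner relation *)

Section CoisometryIdeal.
Variables (R : nuRingType) (sys : Rsystem R) (X : covrep sys).
Hypothesis hFS : condition_FS sys.
Variables (B : nuRingType) (f : X -> B).
Hypothesis fm : nuring_morphism f.

Definition coisometry_ideal : set R := [set r | exists w,
  Delta r = theta_sum w /\ f (covsigma X r - TS_sum X w) = 0].

(** Independence of the chosen decomposition follows from the existence, under (FS), of a lift into
    [X]. *)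
Lemma TS_sum_eq w v : theta_sum w = theta_sum v -> TS_sum X w = TS_sum X v.
Proof.
by have [pi hpi] := theta_lift_exists X hFS; rewrite -!(theta_lift_sum _ hpi) => ->.
Qed.

Lemma coisometry_ideal_ideal : two_sided_ideal coisometry_ideal.
Proof.
have [fB fM] := fm.
split; first split.
- exists [::]; rewrite /TS_sum big_nil subr0 (zmod_morph0 (@sigmaB _ _ _)).
  split; last exact: zmod_morph0.
  by apply/funext => q; rewrite /theta_sum big_nil; exact: (zmod_morph0 (@lactBl _ _ q)).
- move=> r s [w [hr fr]] [v [hs fs]].
  exists (w ++ [seq (- qp.1, qp.2) | qp <- v]); split.
    rewrite theta_sum_cat theta_sum_neg -hr -hs; apply/funext => q.
    exact: lactBl.
  rewrite TS_sum_cat TS_sum_neg sigmaB opprD addrACA -opprD fB fr fs.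
  exact: subrr.
- move=> s r [w [hr fr]]; split.
    exists [seq (s *> qp.1, qp.2) | qp <- w]; split.
      by rewrite theta_sum_mull -hr; apply/funext => q; exact: lactA.
    by rewrite TS_sum_mull sigmaM -numulBr fM fr numulr0.
  exists [seq (qp.1, qp.2 <* s) | qp <- w]; split.
    by rewrite theta_sum_mulr -hr; apply/funext => q; exact: lactA.
  by rewrite TS_sum_mulr sigmaM -numulBl fM fr numul0r.
Qed.

Lemma coisometry_ideal_compatible : psi_compatible sys coisometry_ideal.
Proof. by move=> r [w [hr _]]; exists w. Qed.

(** When [Delta r] is zero, its lift equals the lift of the empty sum, so the relation reads f(sigma
    r) = 0. *)
Lemma coisometry_ideal_faithful : (forall r, f (covsigma X r) = 0 -> r = 0) ->
  faithful_ideal sys coisometry_ideal.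
Proof.
move=> f_sigma; apply/seteqP; split=> [r [[w [hr fr]] kr]|_ ->].
  apply: f_sigma; move: fr; rewrite (@TS_sum_eq w [::]).
    by rewrite /TS_sum big_nil subr0.
  by rewrite -hr kr; apply/funext => q; rewrite /theta_sum big_nil.
split; first exact: coisometry_ideal_ideal.1.1.
by apply/funext => q; exact: (zmod_morph0 (@lactBl _ _ q)).
Qed.

End CoisometryIdeal.

(** * The kernel of the quotient map and injectivity of R into O(J) *)

Section Representation.
Variables (R : nuRingType) (sys : Rsystem R) (T : covrep sys).
Hypotheses (hFS : condition_FS sys) (hT : is_toeplitz T).
Variable pi : (sysQ sys -> sysQ sys) -> T.
Hypothesis hpi : is_theta_lift pi.
Variable J : set R.
Hypotheses (hJ : two_sided_ideal J) (hcompat : psi_compatible sys J).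

(** The union of the levels of [relspan] is an ideal containing the generators of T(J), which sit at
    level one. *)
Lemma CP_kernel x : quot_proj (CP_relations pi J) x = 0 -> exists a, relspan J a x.
Proof.
rewrite -(zmod_morph0 (@quot_proj_zmod_morphism _ (CP_relations pi J))).
move=> /quot_proj_eq; rewrite subr0.
move=> /(_ [set x | exists a, relspan J a x]); apply.
  exact: relspan_ideal hT.1.
move=> _ [r Jr <-]; have [w hw] := hcompat Jr.
by exists 1%N; rewrite hw theta_lift_sum //; apply: relspan_rel.
Qed.

Lemma CP_rel_mem r w : Delta r = theta_sum w ->
  quot_proj (CP_relations pi J) (covsigma T r - TS_sum T w) = 0 -> J r.
Proof.
move=> hr /CP_kernel [a]; have [h [hh _]] := hT.2 (fock_covrep sys).
exact: relspan_rel_mem hh _ _ _.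
Qed.

Lemma CP_injective : faithful_ideal sys J -> injective_covrep (CP pi J).
Proof.
move=> hfaith; apply: zmod_morph_inj; first exact: sigmaB.
move=> r /CP_kernel [a]; have [h [hh _]] := hT.2 (fock_covrep sys).
apply: relspan_sigma hh _ _ _ => // s Js hs.
by have : (J `&` ker_Delta sys) s by []; rewrite hfaith.
Qed.

End Representation.

(** * Surjectivity of morphisms and the equivalence of the three statements *)

Lemma covrep_morph_surj (R : nuRingType) (sys : Rsystem R) (X Y : covrep sys)
  (f : X -> Y) : covrep_morphism f -> surjective_covrep Y -> forall y, exists x, f x = y.
Proof.
move=> hf surjY y; suff : range f y by case=> x _ <-; exists x.
have hs : nu_subring (range f).
  split; [split|].
  - by exists 0 => //; rewrite (zmod_morph0 (covrep_morphB hf)).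
  - by move=> _ _ [u _ <-] [v _ <-]; exists (u - v); rewrite // (covrep_morphB hf).
  - by move=> _ _ [u _ <-] [v _ <-]; exists (u ** v); rewrite // (covrep_morphM hf).
rewrite (surjY _ hs) // => _ [[|]|] [u _ <-].
- by exists (covsigma X u); rewrite // covrep_morph_sigma.
- by exists (covT X u); rewrite // covrep_morphT.
- by exists (covS X u); rewrite // covrep_morphS.
Qed.

Theorem theorem4p7 (R : nuRingType) (sys : Rsystem R) (hFS : condition_FS sys)
    (T : covrep sys) (hT : is_toeplitz T)
    (pi : (sysQ sys -> sysQ sys) -> T) (hpi : is_theta_lift pi)
    (J : set R) (hJ : two_sided_ideal J)
    (hcompat : psi_compatible sys J) (hfaith : faithful_ideal sys J) :
  [<-> graded_uniqueness (CP pi J);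
       minimal_covrep (CP pi J);
       maximal_faithful sys J].
Proof.
tfae.
- move=> uniqJ Y surjY injY [G [hG Gs GT GS]] f hf.
  have fm : nuring_morphism f by case: hf.
  have fs : f \o covsigma (CP pi J) = covsigma Y by case: hf.
  have f_inj : injective f.
    (* The grading of O(J) is by [homog]; [f] respects it because it sends generators to generators
       of the right degrees. *)
    apply: (uniqJ _ (CP_covrep_grading hT hpi hcompat) _ G hG); last by rewrite fs.
    split=> //; apply: homog_graded => // [r|q|p].
    + by rewrite covrep_morph_sigma //; apply: Gs; exists r.
    + by rewrite covrep_morphT //; apply: GT; exists q.
    + by rewrite covrep_morphS //; apply: GS; exists p.
  split=> //; have [g hg] := choice (covrep_morph_surj hf surjY).
  by exists g => // x; apply: f_inj; rewrite hg.
- move=> minJ J' hJ' hcompat' hfaith' sJJ'; apply/seteqP; split=> // r J'r.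
  have [f hf fE] : exists2 f : CP pi J -> CP pi J', covrep_morphism f &
      forall x, f (quot_proj (CP_relations pi J) x) = quot_proj (CP_relations pi J') x.
    apply: CP_lift; first exact: quot_proj_covrep.
    move=> s /sJJ' J's; exact: CP_relation.
  have graded' : graded_covrep (CP pi J').
    by exists (@homog _ _ (CP pi J')); apply: CP_covrep_grading.
  have surj' : surjective_covrep (CP pi J') by exact: CP_surjective.
  have inj' : injective_covrep (CP pi J') by exact: CP_injective.
  have [_ /bij_inj f_inj] := minJ _ surj' inj' graded' f hf.
  have [w hw] := hcompat' r J'r.
  (* The relator of r vanishes in O(J'), so injectivity of [f] makes it vanish already in O(J),
     which forces r into [J]. *)
  apply: (CP_rel_mem hFS hT hpi hJ hcompat hw); apply: f_inj.
  rewrite (zmod_morph0 (covrep_morphB hf)) fE quot_proj_zmod_morphism.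
  apply/eqP; rewrite subr_eq0; apply/eqP.
  by rewrite -(theta_lift_sum w hpi) -[theta_sum w]hw; exact: CP_relation.
- move=> maxJ GX [hGX Gs GT GS] B GB hGB f [fm fG] f_inj.
  have [fB fM] := fm; have rm := quot_proj_covrep pi J.
  have f_sigma r : f (covsigma (CP pi J) r) = 0 -> r = 0.
    move=> fr; apply: f_inj; rewrite /comp fr.
    by rewrite (zmod_morph0 (@sigmaB _ _ (CP pi J))) zmod_morph0.
  have rel0 r w : J r -> Delta r = theta_sum w ->
      covsigma (CP pi J) r - TS_sum (CP pi J) w = 0.
    move=> Jr hr; apply/eqP; rewrite subr_eq0; apply/eqP.
    by rewrite CP_relation // hr theta_lift_sum // (morph_TS_sum _ rm).
  (* Maximality makes every relation that holds after applying f hold already in O(J), as [nf_ker]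
     requires. *)
  have eJ : J = coisometry_ideal f.
    apply: maxJ.
    + exact: coisometry_ideal_ideal.
    + exact: coisometry_ideal_compatible.
    + exact: coisometry_ideal_faithful.
    + move=> r Jr; have [w hw] := hcompat r Jr; exists w; split=> //.
      by rewrite rel0 // zmod_morph0.
  apply: zmod_morph_inj => // x fx.
  (* The decomposition is by [homog], with [GX] entering only through the degrees of generators. As
     f(c n) lies in [GB n], independence in B makes every f(c n) vanish. *)
  have [s [c [us hc ex]]] := homog_span (@CP_surjective _ _ _ hT pi J) x.
  have fc n : GB n (f (c n)).
    apply: (homog_graded fm hGB _ _ _ (hc n)) => [r|q|p]; apply: fG.
    + by apply: Gs; exists r.
    + by apply: GT; exists q.
    + by apply: GS; exists p.
  rewrite ex big_seq big1 // => n ns.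
  have [a [b [_ hab]]] := homog_nf (hc n).
  apply: (nf_ker hFS fm f_sigma _ hab).
    move=> r w hr fr; apply: rel0 => //; rewrite eJ; exists w => //.
  apply: (Zgrading_indep hGB (c := f \o c) us) ns => //=.
  by rewrite -(zmod_morph_sum fB) -ex.
Qed.
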